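(* Let $a\in X$. For sufficiently small initial values $r$ the first return map $P(a)$ is an absolutely convergent power series $P(a)(r)=r+\sum_{n=1}^{\infty}c_n(a)r^{n+1}$, where $$c_n(a)=\sum_{i_1+\dots+i_k=n}c_{i_1,\dots,i_k}\,I_{i_1,\dots,i_k}(a)$$ (the sum over all $k\ge1$ and all positive integers $i_1,\dots,i_k$ with $i_1+\dots+i_k=n$) and $$c_{i_1,\dots,i_k}=(n-i_1+1)\cdot(n-i_1-i_2+1)\cdot(n-i_1-i_2-i_3+1)\cdots 1=\prod_{j=1}^{k}(n-i_1-\dots-i_j+1).$$ The center set $\mathcal{C}\subset X$ of the equation $\frac{dv}{dx}=\sum_{i=1}^\infty a_i(x)v^{i+1}$ is determined by the system of polynomial equations $c_n(a)=0$, $n=1,2,\dots$.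
   Context: Functions on the circle $S^1$ are identified with $2\pi$-periodic functions on $\mathbb{R}$. $X$ is the complex vector space of sequences $a=(a_1,a_2,\dots)$ with $a_i\in L^\infty(S^1)$ (complex-valued) for which there is $l>0$ (depending on $a$) with $\sup_{x\in S^1}|a_i(x)|\le l^i$ for all $i\ge1$ (sup understood as the $L^\infty$-norm). For $a\in X$ and sufficiently small $r$ there is a unique Lipschitz function $v(x;r;a)$, $x\in[0,2\pi]$, satisfying $\frac{dv}{dx}=\sum_{i\ge1}a_i(x)v^{i+1}$ almost everywhere and $v(0;r;a)=r$. The first return map is $P(a)(r):=v(2\pi;r;a)$. The equation determines a center if $v(2\pi;r;a)=r$ for all sufficiently small $r$; $\mathcal{C}\subset X$ is the set of $a\in X$ whose equation determines a center. Basic iterated integrals: $I_{i_1,\dots,i_k}(a)=\int\cdots\int_{0\le s_1\le\cdots\le s_k\le2\pi}a_{i_k}(s_k)\cdots a_{i_1}(s_1)\,ds_k\cdots ds_1$. *)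

(* Defs.v *)
From mathcomp Require Import all_boot all_order all_algebra.
From mathcomp Require Import complex.
From mathcomp Require Import all_classical all_reals all_analysis.

Set Implicit Arguments.
Unset Strict Implicit.
Unset Printing Implicit Defensive.

Import Order.TTheory GRing.Theory Num.Theory.
Import numFieldNormedType.Exports.

Local Open Scope classical_set_scope.
Local Open Scope ring_scope.
Local Open Scope complex_scope.

Notation normc := ComplexField.Normc.normc.

(* [Re], [Im] would denote the operators of closed fields, with values in R[i]. *)
Definition complex_integral (R : realType) (D : set R) (f : R -> R[i]) : R[i] :=
  (\int[lebesgue_measure]_(x in D) complex.Re (f x)) +i*
  (\int[lebesgue_measure]_(x in D) complex.Im (f x)).

(* Limits in R[i] are taken in the normed space [R[i]^o]. *)
Definition has_derivative (R : realType) (v : R -> R[i]) (x : R) (w : R[i]) :=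
  (fun h : R => (h^-1)%:C * (v (x + h) - v x)) @ 0^' --> (w : R[i]^o).

(* A sequence (a_1, a_2, ...) is encoded as [a : nat -> R -> R[i]]; the entry
   [a 0] never plays a role.  Elements of L^oo(S^1) are given by measurable
   2pi-periodic representatives; by periodicity, the L^oo-norm over R is the
   L^oo-norm over the circle. *)
Definition coefficient_space (R : realType) : set (nat -> R -> R[i]) :=
  [set a : nat -> R -> R[i] | (forall i, (0 < i)%N ->
              [/\ measurable_fun setT (fun x : R => complex.Re (a i x)),
                  measurable_fun setT (fun x : R => complex.Im (a i x)) &
                  periodic (a i) (2 * pi)]) /\
           (exists2 l : R, 0 < l & forall i, (0 < i)%N ->
              (Lnorm lebesgue_measure +oo (fun x : R => (normc (a i x))%:E)
                 <= (l ^+ i)%:E)%E)].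

(* Only the values of [v] on [0, 2pi] matter. *)
Definition is_solution (R : realType) (a : nat -> R -> R[i]) (r : R[i])
    (v : R -> R[i]) :=
  [/\ exists L : R, forall x y, x \in `[0, 2 * pi] -> y \in `[0, 2 * pi] ->
        normc (v x - v y) <= L * `|x - y|,
      v 0 = r &
      {ae lebesgue_measure, forall x : R, x \in `]0, 2 * pi[ ->
        exists w : R[i],
          series (fun i => a i.+1 x * v x ^+ i.+2) @ \oo --> (w : R[i]^o) /\
          has_derivative v x w}].

(* v(_; r; a), chosen arbitrarily outside [0, 2pi]; meaningful for those r for
   which the initial value problem is well posed, hence for all small r. *)
Definition solution (R : realType) (a : nat -> R -> R[i]) (r : R[i]) :
  R -> R[i] := xget (cst 0) [set v | is_solution a r v].

Definition first_return_map (R : realType) (a : nat -> R -> R[i]) (r : R[i]) :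
  R[i] := solution a r (2 * pi).

Definition center_set (R : realType) : set (nat -> R -> R[i]) :=
  [set a : nat -> R -> R[i] | coefficient_space a /\
    exists2 rho : R, 0 < rho &
      forall r : R[i], normc r < rho -> first_return_map a r = r].

(* The integral over lo <= s_1 <= ... <= s_k <= 2pi, with [s = [:: i_1; ...; i_k]]
   and nested in the order ds_k ... ds_1, the variable s_k being innermost. *)
Fixpoint iterated_integral_from (R : realType) (a : nat -> R -> R[i]) (lo : R)
    (s : seq nat) : R[i] :=
  if s is i :: s' then
    complex_integral `[lo, 2 * pi]
      (fun t => a i t * iterated_integral_from a t s')
  else 1.

Definition iterated_integral (R : realType) (a : nat -> R -> R[i])
    (s : seq nat) : R[i] := iterated_integral_from a 0 s.

Definition is_composition (n : nat) (s : seq nat) : bool :=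
  all (fun i => (0 < i)%N) s && (sumn s == n).

Definition composition_coef (n : nat) (s : seq nat) : nat :=
  \prod_(1 <= j < (size s).+1) (n - sumn (take j s) + 1)%N.

(* A composition of n has between 1 and n parts, each of them at most n. *)
Definition return_coef (R : realType) (a : nat -> R -> R[i]) (n : nat) : R[i] :=
  \sum_(1 <= k < n.+1)
    \sum_(t : k.-tuple 'I_n.+1 | is_composition n (map val t))
      (composition_coef n (map val t))%:R * iterated_integral a (map val t).

(* Main.v *)
Require Import Defs.
From mathcomp Require Import all_boot all_order all_algebra.
From mathcomp Require Import complex.
From mathcomp Require Import all_classical all_reals all_analysis.
From mathcomp Require Import measurable_realfun ess_sup_inf hoelder.
From mathcomp Require Import ring lra zify.
Set Implicit Arguments.
Unset Strict Implicit.
Unset Printing Implicit Defensive.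
Import Order.TTheory GRing.Theory Num.Theory.
Import numFieldNormedType.Exports.
Local Open Scope classical_set_scope.
Local Open Scope ring_scope.
Local Open Scope complex_scope.

(* Let C_n(x) be the weighted sum of iterated integrals defining c_n, taken over
   x <= s_1 <= ... <= s_k <= 2pi instead.  The product formula for the weights
   says C_n' = - \sum_(1 <= i <= n) (n - i + 1) a_i C_(n-i), i.e. that
   Phi(x, r) = r + \sum_n C_n(x) r^(n+1) satisfies the transport equation
   Phi_x + Phi_r \sum_i a_i r^(i+1) = 0.  Hence Phi(x, v(x)) is constant along a
   small solution v; it equals v(2pi) at x = 2pi, where all C_n vanish, and
   r + \sum_n c_n r^(n+1) at x = 0.  This gives the expansion for any solution,
   existence comes from Picard iteration (the right-hand side has no linear term,
   so it is a contraction near 0), and the center condition follows from the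
   identity theorem for power series. *)

(** Solutions and iterated integrals have derivatives only almost everywhere, and such a derivative
    alone does not control increments. All differentiations therefore act on pairs
    [lip_diff b f f'], a Lipschitz function with its almost everywhere derivative;
    [lipschitz_ae_nonincreasing] turns these into mean value inequalities. Phi itself is never
    differentiated: its truncation at order [N] is, and the terms that fail to cancel are bounded by
    a multiple of [2^-N]. The series along [v] are controlled only where [v] stays in a fixed disc,
    which is not part of being a solution; [small_solution] derives it from a small initial value.
    Since [first_return_map] refers to an unspecified solution, the estimates are made for an
    arbitrary one, and existence guarantees that the choice is a genuine solution. Picard iteration
    is followed on the slopes rather than on the iterates: their pointwise limit is bounded and
    measurable, so its primitive has the required almost everywhere derivative. *)

(** * Modulus, limits and difference quotients in [R[i]] *)

Section complex_norm.
Context (R : realType).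
Implicit Types (x y z : R[i]) (k : R).

Lemma normc_normr z : `|z| = (normc z)%:C. Proof. by []. Qed.

Lemma normc_ge0 z : 0 <= normc z.
Proof. by rewrite -ler0c -normc_normr. Qed.

Lemma normcM x y : normc (x * y) = normc x * normc y.
Proof. exact: ComplexField.Normc.normcM. Qed.

Lemma normc0 : normc (0 : R[i]) = 0.
Proof. exact: ComplexField.Normc.normc0. Qed.

Lemma normc1 : normc (1 : R[i]) = 1.
Proof. exact: ComplexField.Normc.normc1. Qed.

Lemma normcX z n : normc (z ^+ n) = normc z ^+ n.
Proof. by apply: complexI; rewrite rmorphXn -!normc_normr normrX. Qed.

Lemma normcR k : normc k%:C = `|k|.
Proof. by rewrite /= expr0n addr0 sqrtr_sqr. Qed.

Lemma normc_natr n : normc (n%:R : R[i]) = n%:R.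
Proof. by apply: complexI; rewrite -normc_normr normr_nat rmorph_nat. Qed.

Lemma normc_subC x y : normc (x - y) = normc (y - x).
Proof. by apply: complexI; rewrite -!normc_normr distrC. Qed.

Lemma ler_normcD x y : normc (x + y) <= normc x + normc y.
Proof. exact: le_normcD. Qed.

Lemma ler_normcB x y : normc (x - y) <= normc x + normc y.
Proof. by rewrite -(normcN (y : Rcomplex R)); exact: le_normcD. Qed.

Lemma ler_normc_sum (I : Type) (s : seq I) (P : pred I) (F : I -> R[i]) :
  normc (\sum_(i <- s | P i) F i) <= \sum_(i <- s | P i) normc (F i).
Proof.
elim/big_ind2 : _ => //; first by rewrite normc0.
by move=> x a y b xa yb; rewrite (le_trans (ler_normcD _ _))// lerD.
Qed.

Lemma Re_le_normc z : complex.Re z <= normc z.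
Proof.
apply: le_trans (ler_norm _) _; rewrite -lecR -normc_normr.
exact: normc_ge_Re.
Qed.

Lemma normRe_le_normc z : `|complex.Re z| <= normc z.
Proof. by rewrite -lecR -normc_normr; exact: normc_ge_Re. Qed.

Lemma normIm_le_normc z : `|complex.Im z| <= normc z.
Proof.
have := normRe_le_normc (z * 'i%C); rewrite ReiNIm normrN normcM.
by rewrite [normc 'i%C]/= expr0n expr1n add0r sqrtr1 mulr1.
Qed.

Lemma normc_le_ReIm z : normc z <= `|complex.Re z| + `|complex.Im z|.
Proof.
rewrite {1}(complexE z); apply: (le_trans (ler_normcD _ _)).
rewrite normcM !normcR [normc 'i%C]/= expr0n expr1n add0r sqrtr1 mul1r.
exact: lexx.
Qed.

Lemma ReD x y : complex.Re (x + y) = complex.Re x + complex.Re y.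
Proof. by case: x y => [? ?] [? ?]. Qed.

Lemma ImD x y : complex.Im (x + y) = complex.Im x + complex.Im y.
Proof. by case: x y => [? ?] [? ?]. Qed.

Lemma ReB x y : complex.Re (x - y) = complex.Re x - complex.Re y.
Proof. by case: x y => [? ?] [? ?]. Qed.

Lemma ImB x y : complex.Im (x - y) = complex.Im x - complex.Im y.
Proof. by case: x y => [? ?] [? ?]. Qed.

Lemma ReRM k x : complex.Re (k%:C * x) = k * complex.Re x.
Proof. by case: x => u w /=; rewrite mul0r subr0. Qed.

Lemma ImRM k x : complex.Im (k%:C * x) = k * complex.Im x.
Proof. by case: x => u w /=; rewrite mul0r addr0. Qed.

Lemma Re_mulc x y : complex.Re (x * y) =
  complex.Re x * complex.Re y - complex.Im x * complex.Im y.
Proof. by case: x y => [? ?] [? ?]. Qed.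

Lemma Im_mulc x y : complex.Im (x * y) =
  complex.Re x * complex.Im y + complex.Im x * complex.Re y.
Proof. by case: x y => [? ?] [? ?]. Qed.

Lemma cvg_normcP (u : nat -> R[i]) (w : R[i]) :
  (u @ \oo --> (w : R[i]^o)) <->
  (forall e, 0 < e -> \forall n \near \oo, normc (u n - w) < e).
Proof.
rewrite (@cvgrPdist_lt _ R[i]^o); split=> [uw e e0|uw].
  have e0' : (0 : R[i]) < e%:C by rewrite ltcR.
  have := uw _ e0'; apply: filterS => n.
  by rewrite normc_normr ltcR normc_subC.
move=> [e ei]; rewrite ltcE /= => /andP[/eqP-> /uw].
apply: filterS => n.
by rewrite normc_normr -/(real_complex R e) ltcR normc_subC.
Qed.

Lemma cvg_normc_unique (u : nat -> R[i]) (w w' : R[i]) :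
  u @ \oo --> (w : R[i]^o) -> u @ \oo --> (w' : R[i]^o) -> w = w'.
Proof.
move=> /cvg_normcP uw /cvg_normcP uw'.
apply/eqP; rewrite -subr_eq0; apply/eqP/ComplexField.Normc.eq0_normc/eqP.
rewrite eq_le normc_ge0 andbT; apply/ler_addgt0Pr => e e0; rewrite add0r.
have e2 : 0 < e / 2 by rewrite divr_gt0.
near \oo => n.
have -> : w - w' = (u n - w') - (u n - w) by ring.
apply: (le_trans (ler_normcB _ _)); rewrite [leRHS]splitr.
by apply: lerD; apply: ltW; near: n; [exact: uw'|exact: uw].
Unshelve. all: by end_near. Qed.

Lemma cvg_normc_le (u : nat -> R[i]) (w c : R[i]) M :
  u @ \oo --> (w : R[i]^o) ->
  (\forall n \near \oo, normc (u n - c) <= M) -> normc (w - c) <= M.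
Proof.
move=> /cvg_normcP uw uM; apply/ler_addgt0Pr => e e0.
near \oo => n.
have -> : w - c = (u n - c) - (u n - w) by ring.
apply: (le_trans (ler_normcB _ _)); apply: lerD; first by near: n.
by apply: ltW; near: n; exact: uw.
Unshelve. all: by end_near. Qed.

(** Multiplying by [h] makes [h = 0] harmless, so the punctured neighbourhood becomes a full one and
    remainders can simply be added. *)
Lemma has_derivativeP (v : R -> R[i]) (x : R) (w : R[i]) :
  has_derivative v x w <->
  (forall e, 0 < e -> \forall h \near 0,
     normc (v (x + h) - v x - h%:C * w) <= e * `|h|).
Proof.
have H h : h != 0 -> normc (w - (h^-1)%:C * (v (x + h) - v x)) * `|h| =
   normc (v (x + h) - v x - h%:C * w).
  move=> h0; rewrite mulrC -normcR -normcM mulrBr mulrA -rmorphM divff//= mul1r.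
  by rewrite normc_subC.
rewrite /has_derivative (@cvgrPdist_lt _ R[i]^o); split=> [vw e e0|vw].
  have e0' : (0 : R[i]) < e%:C by rewrite ltcR.
  have := vw _ e0'; rewrite near_withinE; apply: filterS => h.
  have [->|h0 /(_ isT)] := eqVneq h 0.
    by move=> _; rewrite addr0 subrr rmorph0 mul0r subr0 normc0 normr0 mulr0.
  by rewrite normc_normr ltcR -H// => /ltW he; rewrite ler_wpM2r.
move=> [e ei]; rewrite ltcE /= => /andP[/eqP-> e0].
have /vw : 0 < e / 2 by rewrite divr_gt0.
rewrite near_withinE; apply: filterS => h + h0.
rewrite -H// ler_pM2r ?normr_gt0// => he.
rewrite normc_normr -/(real_complex R e) ltcR (le_lt_trans he)//.
by rewrite ltr_pdivrMr// ltr_pMr// ltr1n.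
Qed.

End complex_norm.

(** * Lipschitz functions with almost everywhere derivatives *)

Section derivative_rules.
Context (R : realType).
Implicit Types (f g : R -> R[i]) (x : R) (w z : R[i]).

Lemma has_derivative_cst (c : R[i]) x : has_derivative (cst c) x 0.
Proof.
apply/has_derivativeP => e e0; near=> h.
by rewrite subrr mulr0 subr0 normc0 mulr_ge0// ltW.
Unshelve. all: by end_near. Qed.

Lemma has_derivative_real x : has_derivative (real_complex R) x 1.
Proof.
apply/has_derivativeP => e e0; near=> h.
have -> : (x + h)%:C - x%:C - h%:C * 1 = 0 by rewrite rmorphD/=; ring.
by rewrite normc0 mulr_ge0// ltW.
Unshelve. all: by end_near. Qed.

Lemma has_derivativeD f g x w z : has_derivative f x w ->
  has_derivative g x z -> has_derivative (fun t => f t + g t) x (w + z).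
Proof.
move=> /has_derivativeP fw /has_derivativeP gz; apply/has_derivativeP => e e0.
have e2 : 0 < e / 2 by rewrite divr_gt0.
near=> h.
have -> : f (x + h) + g (x + h) - (f x + g x) - h%:C * (w + z) =
  (f (x + h) - f x - h%:C * w) + (g (x + h) - g x - h%:C * z) by ring.
rewrite (le_trans (ler_normcD _ _))// (splitr e) mulrDl lerD//.
  by near: h; exact: fw.
by near: h; exact: gz.
Unshelve. all: by end_near. Qed.

Lemma has_derivativeM f g x w z : has_derivative f x w ->
  has_derivative g x z ->
  has_derivative (fun t => f t * g t) x (w * g x + f x * z).
Proof.
move=> /has_derivativeP fw /has_derivativeP gz; apply/has_derivativeP => e e0.
(* [K] bounds the factors of the remainders of [f] and [g] when [|h| <= 1]; [M] bounds the factor of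
   the quadratic term. Each group is given [e / 2]. *)
pose K := normc (g x) + normc z + 1 + normc (f x).
pose M := normc w * (normc z + 1) + 1.
have K0 : 0 < K.
  by rewrite /K ltr_wpDr ?normc_ge0// ltr_wpDl ?addr_ge0 ?normc_ge0.
have M0 : 0 < M by rewrite /M ltr_wpDl ?mulr_ge0 ?addr_ge0 ?normc_ge0.
have e1 : 0 < e / (2 * K) by rewrite divr_gt0// mulr_gt0.
have e2 : 0 < e / (2 * M) by rewrite divr_gt0// mulr_gt0.
near=> h.
have Fh : normc (f (x + h) - f x - h%:C * w) <= e / (2 * K) * `|h|.
  by near: h; exact: fw.
have Gh : normc (g (x + h) - g x - h%:C * z) <= e / (2 * K) * `|h|.
  by near: h; exact: gz.
have Gh1 : normc (g (x + h) - g x - h%:C * z) <= 1 * `|h|.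
  by near: h; exact: gz.
have h1 : `|h| <= 1 by near: h; apply: (@nbhs0_le _ R^o).
have he : `|h| <= e / (2 * M) by near: h; apply: (@nbhs0_le _ R^o).
have DG : normc (g (x + h) - g x) <= (normc z + 1) * `|h|.
  rewrite -[X in normc X](subrK (h%:C * z)).
  rewrite (le_trans (ler_normcD _ _))// normcM normcR mulrDl addrC lerD//.
  by rewrite mulrC.
have Gb : normc (g (x + h)) <= normc (g x) + normc z + 1.
  rewrite -[X in normc X](subrK (g x)).
  rewrite (le_trans (ler_normcD _ _))// addrC -addrA lerD2l.
  by rewrite (le_trans DG)// ler_piMr// addr_ge0 ?normc_ge0.
have -> : f (x + h) * g (x + h) - f x * g x - h%:C * (w * g x + f x * z) =
  (f (x + h) - f x - h%:C * w) * g (x + h) +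
  f x * (g (x + h) - g x - h%:C * z) + h%:C * w * (g (x + h) - g x) by ring.
apply: le_trans (ler_normcD _ _) _.
apply: le_trans (lerD (ler_normcD _ _) (lexx _)) _.
rewrite !normcM normcR.
have A1 : normc (f (x + h) - f x - h%:C * w) * normc (g (x + h)) <=
   e / (2 * K) * `|h| * (normc (g x) + normc z + 1).
  by apply: ler_pM => //; exact: normc_ge0.
have A2 : normc (f x) * normc (g (x + h) - g x - h%:C * z) <=
   normc (f x) * (e / (2 * K) * `|h|).
  by apply: ler_wpM2l => //; exact: normc_ge0.
have A3 : `|h| * normc w * normc (g (x + h) - g x) <=
   `|h| * (e / (2 * M)) * (normc w * (normc z + 1)).
  apply: (@le_trans _ _ (`|h| * normc w * ((normc z + 1) * `|h|))).
    by apply: ler_wpM2l => //; rewrite mulr_ge0// normc_ge0.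
  rewrite [leLHS](_ : _ = `|h| * (normc w * (normc z + 1)) * `|h|); last by ring.
  rewrite [leRHS]mulrAC ler_wpM2l// mulr_ge0// mulr_ge0 ?addr_ge0 ?normc_ge0//.
apply: (le_trans (lerD (lerD A1 A2) A3)).
have -> : e / (2 * K) * `|h| * (normc (g x) + normc z + 1) +
  normc (f x) * (e / (2 * K) * `|h|) = e / 2 * `|h|.
  transitivity (e / (2 * K) * `|h| * K); first by rewrite /K; ring.
  by field; rewrite gt_eqF.
have A4 : `|h| * (e / (2 * M)) * (normc w * (normc z + 1)) <= e / 2 * `|h|.
  apply: (@le_trans _ _ (`|h| * (e / (2 * M)) * M)).
    by apply: ler_wpM2l; [rewrite mulr_ge0// ltW|rewrite lerDl].
  by rewrite le_eqVlt; apply/orP; left; apply/eqP; field; rewrite gt_eqF.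
by apply: (le_trans (lerD (lexx _) A4)); rewrite -mulrDl -splitr.
Unshelve. all: by end_near. Qed.

Lemma has_derivative_Re f x w : has_derivative f x w ->
  forall e, 0 < e -> \forall h \near 0,
    `|complex.Re (f (x + h)) - complex.Re (f x) - h * complex.Re w| <= e * `|h|.
Proof.
move=> /has_derivativeP fw e e0; have := fw _ e0; apply: filterS => h.
apply: le_trans; apply: le_trans (normRe_le_normc _).
by rewrite !ReB ReRM.
Qed.

End derivative_rules.

Definition lipschitz_itv (R : realType) (b : R) (f : R -> R[i]) :=
  exists2 L : R, 0 <= L & forall x y, x \in `[0, b] -> y \in `[0, b] ->
    normc (f x - f y) <= L * `|x - y|.

(** The derivative is carried as data so that it can be computed by rules. The interval is open
    because the derivative is two-sided and [f] is arbitrary outside [[0, b]]. *)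
Definition lip_diff (R : realType) (b : R) (f f' : R -> R[i]) :=
  lipschitz_itv b f /\ {ae lebesgue_measure, forall x : R, x \in `]0, b[ ->
    has_derivative f x (f' x)}.

Section lebesgue_ae.
Context (R : realType).
Implicit Types P Q S : set R.
Local Notation mu := (@lebesgue_measure R).

Lemma lebesgue_aeS P Q : (forall x, P x -> Q x) ->
  {ae mu, forall x, P x} -> {ae mu, forall x, Q x}.
Proof. by move=> PQ; apply: (@filterS _ _ (ae_filter_ringOfSetsType mu)). Qed.

Lemma lebesgue_aeS2 P Q S : (forall x, P x -> Q x -> S x) ->
  {ae mu, forall x, P x} -> {ae mu, forall x, Q x} -> {ae mu, forall x, S x}.
Proof. by move=> PQ; apply: (@filterS2 _ _ (ae_filter_ringOfSetsType mu)). Qed.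

End lebesgue_ae.

Section lip_diff_rules.
Context (R : realType) (b : R) (b0 : 0 <= b).
Implicit Types (f g : R -> R[i]).

Lemma lipschitz_itv_bounded f : lipschitz_itv b f ->
  exists2 M : R, 0 <= M & forall x, x \in `[0, b] -> normc (f x) <= M.
Proof.
move=> [L L0 fL]; exists (normc (f 0) + L * b).
  by rewrite addr_ge0 ?normc_ge0// mulr_ge0.
move=> x xb; rewrite -[X in normc X](subrK (f 0)) addrC.
rewrite (le_trans (ler_normcD _ _))// lerD2l.
have b00 : 0 \in `[0, b] by rewrite in_itv/= lexx.
rewrite (le_trans (fL _ _ xb b00))// ler_wpM2l// subr0.
by move: xb; rewrite in_itv/= => /andP[x0 xb]; rewrite ger0_norm.
Qed.

Lemma lip_diff_cst (c : R[i]) : lip_diff b (cst c) (cst 0).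
Proof.
split; last by apply: aeW => x _; exact: has_derivative_cst.
by exists 0 => // x y _ _; rewrite subrr normc0 mul0r.
Qed.

Lemma lip_diff_real : lip_diff b (real_complex R) (cst 1).
Proof.
split; last by apply: aeW => x _; exact: has_derivative_real.
by exists 1 => // x y _ _; rewrite -rmorphB normcR mul1r.
Qed.

Lemma lip_diffD f f' g g' : lip_diff b f f' -> lip_diff b g g' ->
  lip_diff b (fun x => f x + g x) (fun x => f' x + g' x).
Proof.
move=> [[L L0 fL] ff'] [[M M0 gM] gg']; split.
  exists (L + M); first by rewrite addr_ge0.
  move=> x y xb yb.
  have -> : f x + g x - (f y + g y) = (f x - f y) + (g x - g y) by ring.
  by rewrite (le_trans (ler_normcD _ _))// mulrDl lerD ?fL ?gM.
apply: lebesgue_aeS2 ff' gg' => x fx gx xb.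
by apply: has_derivativeD; [exact: fx|exact: gx].
Qed.

Lemma lip_diffM f f' g g' : lip_diff b f f' -> lip_diff b g g' ->
  lip_diff b (fun x => f x * g x) (fun x => f' x * g x + f x * g' x).
Proof.
move=> [fl ff'] [gl gg']; split.
  have [B B0 fB] := lipschitz_itv_bounded fl.
  have [C C0 gC] := lipschitz_itv_bounded gl.
  move: fl gl => [L L0 fL] [M M0 gM].
  exists (L * C + B * M); first by rewrite addr_ge0// mulr_ge0.
  move=> x y xb yb.
  have -> : f x * g x - f y * g y = (f x - f y) * g x + f y * (g x - g y).
    by ring.
  rewrite (le_trans (ler_normcD _ _))// [leRHS]mulrDl !normcM lerD//.
    rewrite mulrAC; apply: ler_pM; rewrite ?normc_ge0 ?fL ?gC//.
  rewrite -mulrA; apply: ler_pM; rewrite ?normc_ge0 ?fB ?gM//.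
apply: lebesgue_aeS2 ff' gg' => x fx gx xb.
by apply: has_derivativeM; [exact: fx|exact: gx].
Qed.

Lemma lip_diffZ (c : R[i]) f f' : lip_diff b f f' ->
  lip_diff b (fun x => c * f x) (fun x => c * f' x).
Proof.
move=> /(lip_diffM (lip_diff_cst c)); congr (lip_diff b _ _).
by apply/funext => x /=; rewrite mul0r add0r.
Qed.

Lemma lip_diffB f f' g g' : lip_diff b f f' -> lip_diff b g g' ->
  lip_diff b (fun x => f x - g x) (fun x => f' x - g' x).
Proof.
move=> fd /(lip_diffZ (-1)) /(lip_diffD fd); congr (lip_diff b _ _).
  by apply/funext => x /=; rewrite mulN1r.
by apply/funext => x /=; rewrite mulN1r.
Qed.

Lemma lip_diff_sum (I : eqType) (s : seq I) (F F' : I -> R -> R[i]) :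
  (forall i, i \in s -> lip_diff b (F i) (F' i)) ->
  lip_diff b (fun x => \sum_(i <- s) F i x) (fun x => \sum_(i <- s) F' i x).
Proof.
elim: s => [_|i s IH FF'].
  under eq_fun do rewrite big_nil.
  under [X in lip_diff _ _ X]eq_fun do rewrite big_nil.
  exact: lip_diff_cst.
under eq_fun do rewrite big_cons.
under [X in lip_diff _ _ X]eq_fun do rewrite big_cons.
apply: lip_diffD; first by apply: FF'; rewrite mem_head.
by apply: IH => j js; apply: FF'; rewrite inE js orbT.
Qed.

Lemma lip_diffX f f' n : lip_diff b f f' ->
  lip_diff b (fun x => f x ^+ n.+1) (fun x => n.+1%:R * f x ^+ n * f' x).
Proof.
move=> ff'; elim: n => [|n IH].
  congr (lip_diff b _ _) : ff'.
  by apply/funext => x; rewrite expr0 !mul1r.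
have := lip_diffM ff' IH; congr (lip_diff b _ _).
apply/funext => x; rewrite -[n.+2]addn1 natrD !exprS; ring.
Qed.

End lip_diff_rules.

(** * Monotonicity from almost everywhere derivatives *)

Section mean_value.
Context (R : realType).
Local Notation mu := (@lebesgue_measure R).

(** Let [s] be the supremum of the [x] such that [P] holds on [[a, x]]. The limit hypothesis gives
    [P s], and the step hypothesis would pass beyond [s] if [s < b]. *)
Lemma real_induction (a b : R) (P : R -> Prop) : P a ->
  (forall x, a <= x < b -> (forall y, a <= y <= x -> P y) ->
    exists2 d, 0 < d & forall y, x < y < x + d -> y <= b -> P y) ->
  (forall x, a < x <= b -> (forall y, a <= y < x -> P y) -> P x) ->
  forall x, a <= x <= b -> P x.
Proof.
move=> Pa step lim x0 /andP[ax0 x0b].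
have ab : a <= b by exact: le_trans x0b.
pose S := [set x | a <= x <= b /\ forall y, a <= y <= x -> P y].
have Sa : S a.
  split; first by rewrite lexx.
  by move=> y ya; have -> : y = a by apply/eqP; rewrite eq_le andbC.
have Sub : has_ubound S by exists b => x [/andP[]].
have Ssup : has_sup S by split; [exists a|].
pose s := sup S.
have aLs : a <= s by exact: ub_le_sup.
have sLb : s <= b by apply: ge_sup => [|x [/andP[]]//]; exists a.
have Plt y : a <= y < s -> P y.
  move=> /andP[ay ys]; have [z [_ Pz] yz] := sup_gt (ex_intro _ a Sa) ys.
  by apply: Pz; rewrite ay ltW.
have Ps : P s.
  have [<-//|as_] := eqVneq a s.
  by apply: lim => //; rewrite lt_neqAle as_ aLs.
have Ple y : a <= y <= s -> P y.
  move=> /andP[ay]; rewrite le_eqVlt => /predU1P[->//|ys].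
  by apply: Plt; rewrite ay.
have [sb|] := ltP s b; last first.
  by move=> bs; apply: Ple; rewrite ax0 (le_trans x0b).
have [|d d0 Pd] := step s _ Ple; first by rewrite aLs.
pose z := Num.min b (s + d / 2).
have sz : s < z by rewrite lt_min sb ltrDl divr_gt0.
have : z <= s.
  apply: ub_le_sup => //; split.
    by rewrite (le_trans aLs (ltW sz)) ge_min lexx.
  move=> y /andP[ay yz]; have [ys|sy] := leP y s; first by apply: Ple; rewrite ay.
  have := yz; rewrite le_min => /andP[yb ysd].
  apply: Pd => //; rewrite sy (le_lt_trans ysd)//.
  by rewrite ltrD2l ltr_pdivrMr// ltr_pMr// ltr1n.
by rewrite leNgt sz.
Qed.

Lemma open_cover_null (A : set R) (eps : R) : measurable A -> mu A = 0%E ->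
  0 < eps -> exists U : set R, [/\ open U, A `<=` U & (mu U <= eps%:E)%E].
Proof.
move=> mA A0 e0.
have Aoo : (mu A < +oo)%E by rewrite A0 ltry.
have [U [oU AU UA]] := lebesgue_regularity_outer mA Aoo e0.
exists U; split=> //; have mU : measurable U by exact: open_measurable.
rewrite (_ : U = A `|` (U `\` A)); last by rewrite setDUK.
have AUle : (mu (A `|` (U `\` A)) <= mu A + mu (U `\` A))%E.
  by apply: measureU2 => //; exact: measurableD.
by apply: (le_trans AUle); rewrite A0 add0e ltW.
Qed.

(* Cover the exceptional null set by an open [U] of measure at most [e]; then
   [f x <= f a + e (x - a) + L mu (U `&` [a, x])] propagates to the right, from
   points outside [U] by the derivative bound and from points of [U] because
   there the last term grows at rate [L]. *)
Lemma lipschitz_ae_nonincreasing (a b L : R) (f : R -> R) : a <= b -> 0 <= L ->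
  (forall x y, a <= x <= b -> a <= y <= b -> `|f x - f y| <= L * `|x - y|) ->
  {ae mu, forall x, a < x < b -> forall e : R, 0 < e ->
     exists2 d, 0 < d & forall h, 0 < h < d -> f (x + h) - f x <= e * h} ->
  f b <= f a.
Proof.
move=> ab L0 fL [A [mA A0 NA]]; apply/ler_addgt0Pr => e' e'0.
(* With [e = e' / K] the total loss [e (b - a) + L e] is at most [e']. *)
pose K := b - a + L + 1.
have K0 : 0 < K by rewrite /K; lra.
pose e := e' / K; have e0 : 0 < e by rewrite divr_gt0.
(* The derivative bound is available only for [a < x < b], so the starting point [a] is put into the
   exceptional set. *)
have [|||U [oU AU Ue]] := @open_cover_null (A `|` [set a]) e.
- by apply: measurableU => //; exact: measurable_set1.
- have Aa : (mu (A `|` [set a]) <= mu A + mu [set a])%E by apply: measureU2.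
  apply/eqP; rewrite -measure_le0; apply: (le_trans Aa).
  by rewrite A0 lebesgue_measure_set1 adde0.
- exact: e0.
have mU : measurable U by exact: open_measurable.
have mUI x : measurable (U `&` `[a, x]) by apply: measurableI.
pose m x := fine (mu (U `&` `[a, x])).
have mE x : (mu (U `&` `[a, x]) <= e%:E)%E.
  apply: (le_trans _ Ue).
  by apply: le_measure; rewrite ?inE; [exact: mUI|exact: mU|].
have mfin x : mu (U `&` `[a, x]) \is a fin_num.
  by rewrite ge0_fin_numE// (le_lt_trans (mE x))// ltry.
have me x : m x <= e by rewrite -lee_fin fineK.
have m0 x : 0 <= m x by exact: fine_ge0.
have mle x y : x <= y -> m x <= m y.
  move=> xy; apply: fine_le => //.
  apply: le_measure; rewrite ?inE; [exact: mUI|exact: mUI|].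
  apply: setIS => z /=; rewrite !in_itv/= => /andP[-> /=].
  by move=> /le_trans; apply.
have mD x y : a <= x -> x <= y -> `]x, y] `<=` U -> m x + (y - x) <= m y.
  move=> ax xy xyU.
  have mxy : mu `]x, y] = (y - x)%:E.
    rewrite lebesgue_measure_itv/= lte_fin; case: ltP => [_|yx].
      by rewrite EFinB.
    by have -> : y = x; [apply/eqP; rewrite eq_le yx|rewrite subrr].
  rewrite -lee_fin EFinD fineK// -mxy [leRHS]fineK//.
  have <- : mu ((U `&` `[a, x]) `|` `]x, y]) =
      (mu (U `&` `[a, x]) + mu `]x, y])%E.
    apply: measureU; [exact: mUI|by []|].
    apply/seteqP; split=> // z [[_ /=]]; rewrite !in_itv/= => /andP[_ zx].
    by rewrite ltNge zx.
  apply: le_measure; rewrite ?inE; [|exact: mUI|].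
    by apply: measurableU; [exact: mUI|].
  move=> z [[Uz]|zxy] /=.
    by rewrite !in_itv/= => /andP[-> /=] zx; split=> //; exact: le_trans zx xy.
  split; first exact: xyU.
  move: zxy; rewrite /= !in_itv/= => /andP[xz ->].
  by rewrite (le_trans ax (ltW xz)).
suff H x : a <= x <= b -> f x <= f a + e * (x - a) + L * m x.
  have := H b; rewrite ab lexx => /(_ isT) /le_trans; apply.
  rewrite -addrA lerD2l (@le_trans _ _ (e * (b - a) + L * e))//.
    by rewrite lerD2l ler_wpM2l.
  have -> : e' = e * K by rewrite /e mulfVK// gt_eqF.
  by rewrite (mulrC L) -mulrDr ler_wpM2l ?ltW// /K ltrDl.
move: x; apply: real_induction.
- by rewrite subrr mulr0 addr0 lerDl mulr_ge0.
- move=> x /andP[ax xb] /(_ x); rewrite ax lexx => /(_ isT) Px.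
  have xI : a <= x <= b by rewrite ax ltW.
  have [Ux|NUx] := pselect (U x).
    have /nbhs_ballP[d /= d0 dU] := open_nbhs_nbhs (conj oU Ux).
    exists d => // y /andP[xy yd] yb.
    have yI : a <= y <= b by rewrite yb (le_trans ax (ltW xy)).
    have : m x + (y - x) <= m y.
      apply: mD => //; first exact: ltW.
      move=> z /=; rewrite in_itv/= => /andP[xz zy]; apply: dU.
      by rewrite /ball/= ltr_distlC; apply/andP; split; lra.
    move=> /(ler_wpM2l L0) mxy.
    have := fL _ _ yI xI; rewrite [X in _ <= L * X]gtr0_norm ?subr_gt0//.
    move=> /(le_trans (ler_norm _)) fxy.
    have : e * (x - a) <= e * (y - a) by rewrite ler_wpM2l ?(ltW e0)//; lra.
    by rewrite mulrDr in mxy; lra.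
  have ax' : a < x.
    rewrite lt_neqAle ax andbT; apply/eqP => xa; apply: NUx; apply: AU.
    by right; rewrite /= xa.
  have : a < x < b -> forall e, 0 < e -> exists2 d : R, 0 < d &
      forall h, 0 < h < d -> f (x + h) - f x <= e * h.
    by apply: contra_notP NUx => NP; apply: AU; left; apply: NA.
  rewrite ax' xb => /(_ isT _ e0)[d d0 fd].
  exists d => // y /andP[xy yd] yb.
  have := fd (y - x); rewrite subrKC subr_gt0 xy ltrBlDl yd => /(_ isT) fyx.
  have := ler_wpM2l L0 (mle _ _ (ltW xy)).
  by rewrite mulrBr in fyx; rewrite mulrBr in Px; rewrite mulrBr; lra.
- move=> x /andP[ax xb] Px; apply/ler_addgt0Pr => e1 e10.
  have xI : a <= x <= b by rewrite xb ltW.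
  have L1 : 0 < L + 1 by rewrite ltr_wpDl.
  (* Between [y] and [x] the Lipschitz bound lets [f] vary by at most [e1], while the other two
     terms of the bound are nondecreasing. *)
  pose y := Num.max a (x - e1 / (L + 1)).
  have yx : y < x by rewrite gt_max ax ltrBlDl ltrDr divr_gt0.
  have ay : a <= y by rewrite le_max lexx.
  have yI : a <= y <= b by rewrite ay (le_trans (ltW yx)).
  have := Px y; rewrite ay yx => /(_ isT) Py.
  have : f x - f y <= e1.
    apply: le_trans (ler_norm _) _; apply: le_trans (fL _ _ xI yI) _.
    rewrite gtr0_norm ?subr_gt0//.
    have xy : x - y <= e1 / (L + 1) by rewrite lerBlDl -lerBlDr le_max lexx orbT.
    apply: le_trans (ler_wpM2l L0 xy) _.
    by rewrite mulrA ler_pdivrMr// mulrC ler_wpM2l ?(ltW e10)// lerDl.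
  have := ler_wpM2l L0 (mle _ _ (ltW yx)).
  have : e * (y - a) <= e * (x - a) by rewrite ler_wpM2l ?(ltW e0)//; lra.
  by lra.
Qed.

Context (b : R).
Implicit Types (f g h : R -> R[i]).

Lemma subitv_mem (x y z : R) : 0 <= x -> y <= b -> x <= z <= y ->
  z \in `[0, b].
Proof.
by move=> x0 yb /andP[xz zy]; rewrite in_itv/= (le_trans x0) ?(le_trans zy).
Qed.

Lemma lip_diff_Re_le f f' (x y : R) : lip_diff b f f' -> 0 <= x -> x <= y ->
  y <= b ->
  {ae mu, forall t : R, x < t < y -> complex.Re (f' t) <= 0} ->
  complex.Re (f y) <= complex.Re (f x).
Proof.
move=> [[L L0 fL] ff'] x0 xy yb f'0.
apply: (@lipschitz_ae_nonincreasing _ _ L (fun t => complex.Re (f t))) => //.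
  move=> u v /(subitv_mem x0 yb) ub /(subitv_mem x0 yb) vb.
  by rewrite -ReB (le_trans (normRe_le_normc _))// fL.
apply: lebesgue_aeS2 ff' f'0 => t ft f't txy e e0.
have tb : t \in `]0, b[.
  case/andP: txy => xt ty.
  by rewrite in_itv/= (le_lt_trans x0) ?(lt_le_trans ty).
have := has_derivative_Re (ft tb) e0.
move=> /nbhs_ballP[d /= d0 fd]; exists d => // k /andP[k0 kd].
have := fd k; rewrite /ball/= sub0r normrN gtr0_norm// => /(_ kd).
move=> /(le_trans (ler_norm _)).
have : k * complex.Re (f' t) <= 0 by rewrite pmulr_rle0// f't.
by lra.
Qed.

(** A majorant [h] with varying slope is allowed because the bound on the transport coefficients
    compares them with a power of [1 + b - x]. *)
Lemma lip_diff_normc_le f f' h h' (x y : R) : 0 <= b -> lip_diff b f f' ->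
  lip_diff b h h' -> 0 <= x -> x <= y -> y <= b ->
  {ae mu, forall t : R, x < t < y -> normc (f' t) <= complex.Re (h' t)} ->
  normc (f y - f x) <= complex.Re (h y - h x).
Proof.
move=> b0 ff' hh' x0 xy yb f'h'.
(* multiplying by the conjugate phase [u] of the increment turns its modulus
   into a real part *)
have [u u1 uE] : exists2 u, normc u <= 1 &
    normc (f y - f x) = complex.Re (u * (f y - f x)).
  set w := f y - f x; have [->|w0] := eqVneq w 0.
    by exists 0; rewrite ?normc0// mul0r.
  have nw0 : normc w != 0.
    by apply: contra w0 => /eqP /ComplexField.Normc.eq0_normc ->.
  exists ((normc w)^-1%:C * w^*); last first.
    have ww : w^* * w = (normc w ^+ 2)%:C.
      by rewrite mulrC -sqr_normc normc_normr -rmorphXn.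
    by rewrite -mulrA ww ReRM/= expr2 mulrA mulVf// mul1r.
  rewrite normcM normcR ger0_norm ?invr_ge0 ?normc_ge0//.
  have -> : normc w^* = normc w by apply: complexI; rewrite -!normc_normr normcJ.
  by rewrite mulVf.
have := lip_diffB b0 (lip_diffZ b0 u ff') hh'.
move=> /lip_diff_Re_le /(_ x0 xy yb); rewrite uE mulrBr !ReB.
have -> : forall p q r s : R, (p - q <= r - s) = (p - r <= q - s).
  by move=> p q r s; apply/idP/idP; lra.
apply; apply: lebesgue_aeS f'h' => t f't /f't {}f't.
rewrite ReB subr_le0 (le_trans (Re_le_normc _))// normcM (le_trans _ f't)//.
by rewrite ler_piMl// normc_ge0.
Qed.

Lemma lip_diff_mean_value f f' (M x y : R) : 0 <= b -> lip_diff b f f' ->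
  0 <= x -> x <= y -> y <= b ->
  {ae mu, forall t : R, x < t < y -> normc (f' t) <= M} ->
  normc (f y - f x) <= M * (y - x).
Proof.
move=> b0 ff' x0 xy yb f'M.
have := lip_diff_normc_le b0 ff' (lip_diffZ b0 M%:C (lip_diff_real b)) x0 xy yb.
rewrite -mulrBr -rmorphB ReRM; apply.
by apply: lebesgue_aeS f'M => t f't /f't {}f't; rewrite ReRM /= mulr1.
Qed.

End mean_value.

(** * Primitives of bounded measurable functions *)

Section integral_primitive.
Context (R : realType) (b : R) (b0 : 0 <= b).
Local Notation mu := (@lebesgue_measure R).

Lemma lebesgue_measure_itv_lty (p q : bool) (x y : R) :
  (mu [set` Interval (BSide p x) (BSide q y)] < +oo)%E.
Proof.
by rewrite lebesgue_measure_itv; case: ifPn => // _; rewrite -EFinB ltry.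
Qed.

Lemma bounded_itv_integrable (f : R -> R) (M x y : R) :
  measurable_fun [set` `[0, b]] f ->
  (forall t, t \in `[0, b] -> `|f t| <= M) -> 0 <= x -> y <= b ->
  mu.-integrable [set` `[x, y]] (EFin \o f).
Proof.
move=> mf fM x0 yb; apply: (@integrableS _ _ _ mu [set` `[0, b]]) => //.
  by apply: subset_itv; rewrite bnd_simp.
apply: measurable_bounded_integrable => //; first exact: lebesgue_measure_itv_lty.
exists M; split; first exact: num_real.
by move=> N MN t tb; rewrite /= (le_trans (fM _ tb))// ltW.
Qed.

(** Extend [f] by 0 to [f0] and let [G] be the primitive of [f0] from minus infinity. Then
    [F = G b - G] on [[0, b]], and Lebesgue differentiation of [G] gives the claim with the opposite
    sign. *)
Lemma Rintegral_primitive (f : R -> R) (M : R) :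
  measurable_fun [set` `[0, b]] f ->
  (forall t, t \in `[0, b] -> `|f t| <= M) ->
  let F x := \int[mu]_(t in [set` `[x, b]]) f t in
  (forall x y, 0 <= x -> x <= y -> y <= b -> `|F x - F y| <= M * (y - x)) /\
  {ae mu, forall x, x \in `]0, b[ -> forall e : R, 0 < e ->
     \forall h \near 0, `|F (x + h) - F x + h * f x| <= e * `|h| }.
Proof.
move=> mf fM F.
have intf x y := @bounded_itv_integrable f M x y mf fM.
pose f0 := f \_ [set` `[0, b]].
have intf0 : mu.-integrable setT (EFin \o f0).
  by rewrite /f0 -restrict_EFin -integrable_mkcond//; exact: intf.
have intf0S (i : interval R) : mu.-integrable [set` i] (EFin \o f0).
  by apply: (@integrableS _ _ _ mu setT).
pose G x := \int[mu]_(t in [set` `]-oo, x]]) f0 t.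
have FE x : 0 <= x -> x <= b -> F x = G b - G x.
  move=> x0 xb; rewrite /G Rintegral_itvB//.
  rewrite Rintegral_itv_obnd_cbnd//.
  apply: eq_Rintegral => t; rewrite inE/= in_itv/= => /andP[xt tb].
  by rewrite /f0 patchE mem_set//= in_itv/= (le_trans x0 xt).
split=> [x y x0 xy yb|].
  rewrite (FE x)// ?(FE y) ?(le_trans x0)// ?(le_trans xy)//.
  have -> : G b - G x - (G b - G y) = G y - G x by ring.
  rewrite /G Rintegral_itvB//.
  apply: le_trans (le_normr_Rintegral _ _) _ => //.
  have -> : M * (y - x) = \int[mu]_(t in [set` `]x, y]]) M.
    rewrite Rintegral_cst//= lebesgue_measure_itv/= lte_fin.
    case: ltP => [_|yx]; first by [].
    have -> : y = x by apply/eqP; rewrite eq_le yx.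
    by rewrite subrr.
  apply: le_Rintegral => //.
  - exact: (integrable_norm (intf0S _)).
  - apply: measurable_bounded_integrable => //.
      exact: lebesgue_measure_itv_lty.
    exists `|M|; split; first exact: num_real.
    by move=> N MN t _ /=; rewrite ltW.
  - move=> t; rewrite /= in_itv/= => /andP[xt ty].
    have tb : t \in `[0, b].
      by rewrite in_itv/= (le_trans x0 (ltW xt)) (le_trans ty yb).
    by rewrite /f0 patchE mem_set// fM.
have locf0 : locally_integrable setT f0.
  by apply: open_integrable_locally => //; exact: openT.
have := FTC1Ny (fun y => intf0S `]-oo, y]) locf0.
apply: lebesgue_aeS => x [dG Gx] xb e e0.
have {dG Gx} : h^-1 *: (G (h + x) - G x) @[h --> 0^'] --> f0 x.
  rewrite -Gx /derive1; move/cvg_ex : dG => [l dG].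
  have /cvg_lim -> // : h^-1 *: (G (h + x) - G x) @[h --> 0^'] --> l.
    by move: dG; under eq_fun do rewrite /= [_ *: 1]mulr1.
  by move: dG; under eq_fun do rewrite /= [_ *: 1]mulr1.
move=> /cvgrPdist_le /(_ _ e0); rewrite near_withinE => dG.
move: xb; rewrite in_itv/= => /andP[x0 xb].
have f0x : f0 x = f x by rewrite /f0 patchE mem_set//= in_itv/= !ltW.
near=> h.
have h1 : `|h| <= Num.min x (b - x).
  near: h; apply: (@nbhs0_le _ R^o).
  by rewrite lt_min x0 subr_gt0.
have /andP[hx hb] : (`|h| <= x) && (`|h| <= b - x) by rewrite -le_min.
have /andP[hx1 hx2] : - x <= h <= x by rewrite -ler_norml.
have /andP[hb1 hb2] : - (b - x) <= h <= b - x by rewrite -ler_norml.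
rewrite !FE; [|lra..].
have [->|h0] := eqVneq h 0.
  by rewrite addr0 subrr mul0r addr0 !normr0 mulr0 lexx.
have : `|f0 x - h^-1 *: (G (h + x) - G x)| <= e by move: h0; near: h.
move=> /(ler_wpM2r (normr_ge0 h)); rewrite -normrM f0x; apply: le_trans.
rewrite le_eqVlt; apply/orP; left; apply/eqP; congr `|_|.
by rewrite /GRing.scale/= (addrC h); field.
Unshelve. all: by end_near. Qed.

(** Clamping [f] between [- M] and [M] alters it only on a null set, which affects neither the
    integrals nor an almost everywhere derivative. *)
Lemma Rintegral_ae_primitive (f : R -> R) (M : R) : 0 <= M ->
  measurable_fun [set` `[0, b]] f ->
  {ae mu, forall t, t \in `[0, b] -> `|f t| <= M} ->
  let F x := \int[mu]_(t in [set` `[x, b]]) f t in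
  (forall x y, 0 <= x -> x <= y -> y <= b -> `|F x - F y| <= M * (y - x)) /\
  {ae mu, forall x, x \in `]0, b[ -> forall e : R, 0 < e ->
     \forall h \near 0, `|F (x + h) - F x + h * f x| <= e * `|h| }.
Proof.
move=> M0 mf fM F.
pose f1 := (cst (- M)) \max (f \min (cst M)).
have mf1 : measurable_fun [set` `[0, b]] f1.
  by apply: measurable_maxr => //; exact: measurable_minr.
have f1M t : t \in `[0, b] -> `|f1 t| <= M.
  move=> _; rewrite ler_norml /f1/= le_max lexx/= ge_max ge_min lexx orbT andbT.
  by rewrite (le_trans _ M0)// oppr_le0.
have f1E t : `|f t| <= M -> f1 t = f t.
  rewrite ler_norml /f1/= => /andP[Mf fM'].
  by rewrite (min_idPl fM') (max_idPr Mf).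
have FE x : 0 <= x -> F x = \int[mu]_(t in [set` `[x, b]]) f1 t.
  move=> x0; rewrite /F /Rintegral; congr fine; apply: ae_eq_integral => //.
  - apply/measurable_EFinP; apply: measurable_funS mf => //.
    by apply: subset_itv; rewrite bnd_simp.
  - apply/measurable_EFinP; apply: measurable_funS mf1 => //.
    by apply: subset_itv; rewrite bnd_simp.
  - apply: lebesgue_aeS fM => t fM; rewrite /= in_itv/= => /andP[xt tb].
    by rewrite f1E// fM// in_itv/= (le_trans x0).
have [FL Fd] := Rintegral_primitive mf1 f1M.
split=> [x y x0 xy yb|].
  by rewrite !FE// ?(le_trans x0)// FL.
apply: lebesgue_aeS2 fM Fd => x fM Fd xb e e0.
have x0 : 0 < x by move: xb; rewrite in_itv/= => /andP[].
have fx : f x = f1 x.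
  by rewrite f1E// fM//; move: xb; rewrite !in_itv/= => /andP[/ltW-> /ltW->].
near=> h.
rewrite fx !FE ?(ltW x0)//.
  by near: h; exact: Fd.
have h1 : `|h| <= x by near: h; apply: (@nbhs0_le _ R^o).
by move: h1; rewrite ler_norml => /andP[? ?]; lra.
Unshelve. all: by end_near. Qed.

Definition measurable_itv_fun (f : R -> R[i]) :=
  measurable_fun [set` `[0, b]] (fun t => complex.Re (f t)) /\
  measurable_fun [set` `[0, b]] (fun t => complex.Im (f t)).

Lemma lip_diff_integral (f : R -> R[i]) (M : R) : 0 <= M ->
  measurable_itv_fun f ->
  {ae mu, forall t, t \in `[0, b] -> normc (f t) <= M} ->
  lip_diff b (fun x => complex_integral [set` `[x, b]] f) (fun x => - f x).
Proof.
move=> M0 [mRe mIm] fM.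
have fRe : {ae mu, forall t, t \in `[0, b] -> `|complex.Re (f t)| <= M}.
  by apply: lebesgue_aeS fM => t fM /fM; apply: le_trans; exact: normRe_le_normc.
have fIm : {ae mu, forall t, t \in `[0, b] -> `|complex.Im (f t)| <= M}.
  by apply: lebesgue_aeS fM => t fM /fM; apply: le_trans; exact: normIm_le_normc.
have [LRe dRe] := Rintegral_ae_primitive M0 mRe fRe.
have [LIm dIm] := Rintegral_ae_primitive M0 mIm fIm.
split.
  exists (2 * M); first by rewrite mulr_ge0.
  suff H x y : 0 <= x -> x <= y -> y <= b ->
      normc (complex_integral [set` `[x, b]] f -
             complex_integral [set` `[y, b]] f) <= 2 * M * (y - x).
    move=> x y xI yI.
    have /andP[x0 xb] : 0 <= x <= b by move: xI; rewrite in_itv.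
    have /andP[y0 yb] : 0 <= y <= b by move: yI; rewrite in_itv.
    have [xy|yx] := leP x y.
      by rewrite distrC ger0_norm ?subr_ge0// H.
    by cbv beta; rewrite normc_subC gtr0_norm ?subr_gt0// H// ltW.
  move=> x0 xy yb; apply: le_trans (normc_le_ReIm _) _.
  rewrite ReB ImB (mulrDl 1 1) !mul1r mulrDl lerD//.
    exact: LRe.
  exact: LIm.
apply: lebesgue_aeS2 dRe dIm => x dRe dIm xb.
apply/has_derivativeP => e e0; have e2 : 0 < e / 2 by rewrite divr_gt0.
near=> h; apply: le_trans (normc_le_ReIm _) _.
rewrite !ReB !ImB ReRM ImRM (splitr e) mulrDl; apply: lerD.
  have -> : complex.Re (- f x) = - complex.Re (f x) by case: (f x).
  by rewrite mulrN opprK; near: h; exact: dRe.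
have -> : complex.Im (- f x) = - complex.Im (f x) by case: (f x).
by rewrite mulrN opprK; near: h; exact: dIm.
Unshelve. all: by end_near. Qed.

Lemma complex_integral_itv1 (f : R -> R[i]) :
  complex_integral [set` `[b, b]] f = 0.
Proof. by rewrite /complex_integral set_itv1 !Rintegral_set1. Qed.

(** Composing [f] with the retraction [c] of the line onto [[0, b]] gives a function continuous
    everywhere that agrees with [f] on the interval. *)
Lemma lipschitz_measurable_real (f : R -> R) (L : R) :
  (forall x y, x \in `[0, b] -> y \in `[0, b] -> `|f x - f y| <= L * `|x - y|) ->
  measurable_fun [set` `[0, b]] f.
Proof.
move=> fL; pose c t := Num.max 0 (Num.min b t).
have cb t : c t \in `[0, b].
  by rewrite in_itv/= /c le_max lexx/= ge_max b0 ge_min lexx.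
have cE t : t \in `[0, b] -> c t = t.
  by rewrite in_itv/= /c => /andP[t0 tb]; rewrite (min_idPr tb) (max_idPr t0).
have cL x y : `|c x - c y| <= `|x - y|.
  have H u v : u <= v -> `|c u - c v| <= `|u - v|.
    move=> uv; rewrite distrC (distrC u) (ger0_norm (_ : 0 <= v - u)) ?subr_ge0//.
    by rewrite /c ler_norml; apply/andP; split; case: (leP b u) => ?;
      case: (leP b v) => ?; do ?[case: (leP 0 _) => ?]; lra.
  by have [xy|/ltW yx] := leP x y; [exact: H|rewrite distrC (distrC x) H].
have cf : continuous (fun t => f (c t)).
  move=> x; apply/cvgrPdist_le => e e0; near=> y.
  apply: (le_trans (fL _ _ (cb _) (cb _))).
  have L1 : 0 < `|L| + 1 by rewrite ltr_wpDl.
  have xy : `|x - y| <= e / (`|L| + 1).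
    near: y; apply: (@cvgr_dist_le _ R^o) => //; rewrite ?divr_gt0//.
  apply: (@le_trans _ _ ((`|L| + 1) * (e / (`|L| + 1)))).
    apply: (@le_trans _ _ ((`|L| + 1) * `|c x - c y|)).
      by rewrite ler_wpM2r// (le_trans (ler_norm L))// lerDl.
    by rewrite ler_wpM2l ?(ltW L1)// (le_trans (cL _ _)).
  by rewrite mulrC mulfVK// gt_eqF.
apply: (@eq_measurable_fun _ _ _ _ _ (fun t => f (c t))).
  by move=> t; rewrite inE/= => tb; rewrite cE.
by apply: measurable_funS (continuous_measurable_fun cf).
Unshelve. all: by end_near. Qed.

Lemma lipschitz_itv_measurable (f : R -> R[i]) : lipschitz_itv b f ->
  measurable_itv_fun f.
Proof.
move=> [L L0 fL]; split; apply: (@lipschitz_measurable_real _ L) => x y xb yb.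
  by rewrite -ReB (le_trans (normRe_le_normc _))// fL.
by rewrite -ImB (le_trans (normIm_le_normc _))// fL.
Qed.

Lemma measurable_itv_cst (c : R[i]) : measurable_itv_fun (cst c).
Proof. by split; exact: measurable_cst. Qed.

Lemma measurable_itvD (f g : R -> R[i]) : measurable_itv_fun f ->
  measurable_itv_fun g -> measurable_itv_fun (fun t => f t + g t).
Proof.
move=> [mf mf'] [mg mg']; split; cbv beta.
  by under [X in measurable_fun _ X]eq_fun do rewrite ReD; exact: measurable_funD.
by under [X in measurable_fun _ X]eq_fun do rewrite ImD; exact: measurable_funD.
Qed.

Lemma measurable_itvM (f g : R -> R[i]) : measurable_itv_fun f ->
  measurable_itv_fun g -> measurable_itv_fun (fun t => f t * g t).
Proof.
move=> [mf mf'] [mg mg']; split; cbv beta.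
  under [X in measurable_fun _ X]eq_fun do rewrite Re_mulc.
  by apply: measurable_funB; exact: measurable_funM.
under [X in measurable_fun _ X]eq_fun do rewrite Im_mulc.
by apply: measurable_funD; exact: measurable_funM.
Qed.

Lemma measurable_itvX (f : R -> R[i]) n : measurable_itv_fun f ->
  measurable_itv_fun (fun t => f t ^+ n).
Proof.
move=> mf; elim: n => [|n IH]; first exact: measurable_itv_cst.
by under eq_fun do rewrite exprS; exact: measurable_itvM.
Qed.

Lemma measurable_itv_sum (F : nat -> R -> R[i]) (s : seq nat) :
  (forall i, measurable_itv_fun (F i)) ->
  measurable_itv_fun (fun t => \sum_(i <- s) F i t).
Proof.
move=> mF; elim: s => [|i s IH].
  by under eq_fun do rewrite big_nil; exact: measurable_itv_cst.
by under eq_fun do rewrite big_cons; exact: measurable_itvD.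
Qed.

End integral_primitive.

(** * Transport coefficients *)

(** Compositions of [n] into [k] parts, listed by their first part: this is the recursion that
    [iterated_integral_from] follows, which a sum over tuples hides. *)
Fixpoint comps (k n : nat) : seq (seq nat) :=
  if k is k'.+1 then [seq i :: s | i <- iota 1 n, s <- comps k' (n - i)]
  else if n == 0 then [:: [::]] else [::].

Section compositions.

Lemma compsS k n :
  comps k.+1 n = [seq i :: s | i <- iota 1 n, s <- comps k (n - i)].
Proof. by []. Qed.

Lemma mem_comps k n s :
  (s \in comps k n) = (size s == k) && is_composition n s.
Proof.
elim: k n s => [|k IH] n s.
  rewrite /=; case: eqVneq => [->|n0]; case: s => [|i s]//=.
  by rewrite in_nil /is_composition/= eq_sym (negbTE n0).
apply/allpairsPdep/idP => [[i [t []]]|].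
  rewrite mem_iota add1n ltnS => /andP[i0 iN].
  rewrite IH => /andP[/eqP<- /andP[tp /eqP ts]] ->.
  by rewrite /is_composition/= eqxx i0 tp ts subnKC ?eqxx.
case: s => [//|i s] /= /andP[sk /andP[/= /andP[i0 sp] /eqP sn]].
exists i, s; split=> //; first by rewrite mem_iota i0 add1n ltnS -sn leq_addr.
by rewrite IH -eqSS sk /is_composition sp -sn addKn eqxx.
Qed.

Lemma uniq_comps k n : uniq (comps k n).
Proof.
elim: k n => [|k IH] n /=; first by case: eqP.
apply: allpairs_uniq_dep; first exact: iota_uniq.
  by move=> i _; exact: IH.
by move=> [i s] [j t] _ _ /= [-> ->].
Qed.

Lemma comps_nil k n : (n < k)%N -> comps k n = [::].
Proof.
move=> nk; case E : (comps k n) => [//|s t].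
have : s \in comps k n by rewrite E mem_head.
rewrite mem_comps => /andP[/eqP sk /andP[sp /eqP sn]]; suff : (k <= n)%N by lia.
rewrite -sk -sn; elim: s sp {E sk sn} => //= i s IH /andP[i0 /IH]; lia.
Qed.

Lemma sum_tuple_comps (V : nmodType) (n k : nat) (F : seq nat -> V) :
  \sum_(t : k.-tuple 'I_n.+1 | is_composition n (map val t)) F (map val t) =
  \sum_(s <- comps k n) F s.
Proof.
pose h (t : k.-tuple 'I_n.+1) : seq nat := map val t.
rewrite -big_filter -(big_map h xpredT F).
apply: perm_big; apply: uniq_perm; last 2 first.
- exact: uniq_comps.
- move=> s; rewrite mem_comps; apply/mapP/andP.
    move=> [t]; rewrite mem_filter => /andP[tn _] ->.
    by split; [rewrite /h size_map size_tuple|exact: tn].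
  move=> [/eqP sk sn].
  have sle : forall i, i \in s -> (i <= n)%N.
    move=> i is_; have /andP[_ /eqP <-] := sn.
    elim: s is_ {sk sn} => //= j s IH; rewrite inE => /predU1P[->|/IH].
      exact: leq_addr.
    by move/leq_trans; apply; exact: leq_addl.
  have mapE : map val (map (@inord n) s) = s.
    rewrite -map_comp -[RHS]map_id; apply/eq_in_map => i /sle iN /=.
    by rewrite inordK.
  have sz : size (map (@inord n) s) == k by rewrite size_map sk.
  exists (Tuple sz); last by rewrite /h/= mapE.
  by rewrite mem_filter/= mapE sn mem_index_enum.
rewrite map_inj_uniq; first by rewrite filter_uniq// index_enum_uniq.
by move=> t u /(inj_map val_inj) /val_inj.
Qed.

Lemma composition_coef_nil n : composition_coef n [::] = 1%N.
Proof. by rewrite /composition_coef big_geq. Qed.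

(** The factors after the first involve only [n - i] and partial sums of [s]. This self-similarity
    produces the recursion in [lip_diff_transport_coef]. *)
Lemma composition_coef_cons n i s :
  composition_coef n (i :: s) = ((n - i + 1) * composition_coef (n - i) s)%N.
Proof.
rewrite /composition_coef [size _]/= big_ltn//= take0 /= addn0; congr (_ * _)%N.
by rewrite big_add1/=; apply: eq_bigr => j _; rewrite subnDA.
Qed.

End compositions.

Section transport_coefficients.
Context (R : realType) (a : nat -> R -> R[i]).
Local Notation mu := (@lebesgue_measure R).
Local Notation b := (2 * pi).

Lemma twopi_ge0 : 0 <= b :> R.
Proof. by rewrite mulr_ge0// pi_ge0. Qed.

Context (l : R) (l0 : 0 < l).
Context (ma : forall i, (0 < i)%N -> measurable_itv_fun b (a i)).
Context (al : {ae mu, forall x, forall i, (0 < i)%N -> normc (a i x) <= l ^+ i}).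

(** By induction the inner integral is Lipschitz, hence bounded and measurable, so its product with
    [a i] may be integrated again; the minus sign comes from the moving lower endpoint. *)
Lemma lip_diff_iterated_integral i s : all (fun i => (0 < i)%N) (i :: s) ->
  lip_diff b (fun x => iterated_integral_from a x (i :: s))
    (fun x => - (a i x * iterated_integral_from a x s)).
Proof.
elim: s i => [|j s IH] i.
  move=> /andP[i0 _]; apply: (@lip_diff_integral _ _
    (fun t => a i t * iterated_integral_from a t [::]) (l ^+ i)).
  - by rewrite exprn_ge0// ltW.
  - by apply: measurable_itvM; [exact: ma|exact: measurable_itv_cst].
  - by apply: lebesgue_aeS al => x ax _; rewrite /= mulr1 ax.
move=> /andP[i0 js]; have [Kl _] := IH j js.
have [M M0 KM] := lipschitz_itv_bounded twopi_ge0 Kl.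
apply: (@lip_diff_integral _ _
  (fun t => a i t * iterated_integral_from a t (j :: s)) (l ^+ i * M)).
- by rewrite mulr_ge0// exprn_ge0// ltW.
- apply: measurable_itvM; first exact: ma.
  by apply: lipschitz_itv_measurable; [exact: twopi_ge0|exact: Kl].
- apply: lebesgue_aeS al => x ax xb; rewrite normcM.
  by apply: ler_pM; rewrite ?normc_ge0 ?ax// KM.
Qed.

(* The return map from the section at [x] to the section at [2 * pi] sends
   [r] to [\sum_n transport_coef n x * r ^+ n.+1]. *)
Definition transport_coef (n : nat) (x : R) : R[i] :=
  \sum_(0 <= k < n.+1) \sum_(s <- comps k n)
    (composition_coef n s)%:R * iterated_integral_from a x s.

(** [transport_coef] also sums over [k = 0], so that its value at [n = 0] is 1; a positive [n] has
    no composition without parts. *)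
Lemma return_coefE n : (0 < n)%N -> return_coef a n = transport_coef n 0.
Proof.
case: n => // n _; rewrite /transport_coef big_ltn//= big_nil add0r.
apply: eq_bigr => k _.
exact: (sum_tuple_comps _ _ (fun s =>
  (composition_coef n.+1 s)%:R * iterated_integral_from a 0 s)).
Qed.

Lemma transport_coef0 x : transport_coef 0 x = 1.
Proof.
by rewrite /transport_coef big_nat1 /= big_seq1 composition_coef_nil mulr1.
Qed.

Lemma transport_coef_end n : transport_coef n.+1 b = 0.
Proof.
rewrite /transport_coef big1// => k _; rewrite big_seq big1// => s.
rewrite mem_comps => /andP[_]; case: s => [|i s _]; first by [].
by rewrite /= complex_integral_itv1 mulr0.
Qed.

Lemma lip_diff_transport_coef n : lip_diff b (transport_coef n.+1)
  (fun x => - \sum_(1 <= i < n.+2)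
     (n.+1 - i + 1)%:R * (a i x * transport_coef (n.+1 - i) x)).
Proof.
pose D s (x : R) : R[i] := if s is i :: s' then
   - (a i x * iterated_integral_from a x s') else 0.
have : lip_diff b (fun x => \sum_(k <- index_iota 0 n.+2)
    \sum_(s <- comps k n.+1)
      (composition_coef n.+1 s)%:R * iterated_integral_from a x s)
  (fun x => \sum_(k <- index_iota 0 n.+2) \sum_(s <- comps k n.+1)
     (composition_coef n.+1 s)%:R * D s x).
  apply: lip_diff_sum => k _; apply: lip_diff_sum => s.
  rewrite mem_comps => /andP[_]; case: s => [|i s]//= /andP[sp _].
  apply: lip_diffZ; first exact: twopi_ge0.
  exact: lip_diff_iterated_integral sp.
congr lip_diff; apply/funext => x.
rewrite big_ltn// [comps 0 _]/= big_nil add0r big_add1 [n.+2.-1]/=.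
under eq_bigr => k _.
  rewrite compsS big_allpairs_dep.
  under eq_bigr => i _.
    under eq_bigr => s _.
      rewrite composition_coef_cons natrM /= mulrN.
      rewrite [X in - X](_ : _ = (n.+1 - i + 1)%:R * (a i x *
        ((composition_coef (n.+1 - i) s)%:R * iterated_integral_from a x s)));
        last by ring.
      over.
    rewrite sumrN -!big_distrr/=; over.
  rewrite sumrN; over.
(* Summing first over the first part [i] leaves, for each [i], a sum over compositions of
   [n.+1 - i]. *)
rewrite sumrN exchange_big; congr (- _).
have -> : iota 1 n.+1 = index_iota 1 n.+2 by rewrite /index_iota subSS subn0.
rewrite big_nat [RHS]big_nat; apply: eq_bigr => i /andP[i0 _].
rewrite -!big_distrr/=; congr (_ * (_ * _)); rewrite /transport_coef.
have ni : ((n.+1 - i).+1 <= n.+1)%N by lia.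
(* The range of [k] is longer than in the definition of the smaller coefficient; the excess terms
   have more parts than [n.+1 - i] allows. *)
rewrite (big_cat_nat _ ni)//=.
rewrite [X in _ + X]big_nat_cond [X in _ + X]big1 ?addr0// => k.
by move=> /andP[/andP[kn _] _]; rewrite comps_nil ?big_nil.
Qed.

End transport_coefficients.

(** * Geometric growth of the transport coefficients *)

Section transport_bound.
Context (R : realType) (a : nat -> R -> R[i]).
Local Notation mu := (@lebesgue_measure R).
Local Notation b := (2 * pi).
Context (l : R) (l0 : 0 < l).
Context (ma : forall i, (0 < i)%N -> measurable_itv_fun b (a i)).
Context (al : {ae mu, forall x, forall i, (0 < i)%N -> normc (a i x) <= l ^+ i}).

Lemma sum_half m : \sum_(1 <= i < m.+1) (2^-1 : R) ^+ i = 1 - 2^-1 ^+ m.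
Proof.
elim: m => [|m IH]; first by rewrite big_geq// expr0 subrr.
by rewrite big_nat_recr//= IH exprS; field; rewrite ?expf_neq0.
Qed.

(* The weights can be as large as [n!], so bounding the iterated integrals by
   [l ^+ n * b ^+ k] is not enough; the factor [(1 + b - x) ^+ n], whose
   derivative produces a factor [n], absorbs the weights in the recursion. *)
Lemma normc_transport_coef n x : x \in `[0, b] ->
  normc (transport_coef a n x) <= (2 * l) ^+ n * (1 + b - x) ^+ n.
Proof.
have b0 := @twopi_ge0 R.
elim/ltn_ind: n x => -[|n] IH x xb.
  by rewrite transport_coef0 !expr0 mulr1 normc1.
have /andP[x0 xb'] : 0 <= x <= b by move: xb; rewrite in_itv.
(* The majorant is the negated bound: it increases, and its slope carries the factor [n.+1] that
   dominates the weights. *)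
have hd := lip_diffZ b0 (- ((2 * l) ^+ n.+1))%:C (lip_diffX b0 n
  (lip_diffB b0 (lip_diff_cst b (1 + b)%:C) (lip_diff_real b))).
have {}hd : lip_diff b (fun t => (- ((2 * l) ^+ n.+1 * (1 + b - t) ^+ n.+1))%:C)
    (fun t => ((2 * l) ^+ n.+1 * (n.+1%:R * (1 + b - t) ^+ n))%:C).
  congr (lip_diff b _ _) : hd; apply/funext => t; rewrite /cst.
    by rewrite !(rmorphN, rmorphM, rmorphXn, rmorphB)/= mulNr.
  rewrite !(rmorphN, rmorphM, rmorphXn, rmorphB, rmorph_nat)/=; ring.
have := lip_diff_normc_le b0 (lip_diff_transport_coef l0 ma al n) hd x0 xb'
  (lexx b).
rewrite transport_coef_end sub0r.
rewrite (normcN (transport_coef a n.+1 x : Rcomplex R)) -rmorphB.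
move=> H; apply: le_trans (H _) _ => {H}; last first.
  rewrite [leLHS]/= addrK expr1n mulr1 opprK addrC gerBl.
  by rewrite exprn_ge0// mulr_ge0// ltW.
apply: lebesgue_aeS al => t at_ /andP[xt tb].
rewrite [complex.Re _]/=.
have t0 : 0 <= t by rewrite (le_trans x0)// ltW.
have bt : 1 <= 1 + b - t by rewrite -addrA lerDl subr_ge0 ltW.
have bt0 : 0 <= 1 + b - t by exact: le_trans bt.
have tI : t \in `[0, b] by rewrite in_itv/= t0 ltW.
have l2 : 0 <= 2 * l by rewrite mulr_ge0// ltW.
rewrite (normcN (_ : Rcomplex R)); apply: (le_trans (ler_normc_sum _ _ _)).
(* [a i] uses only [l ^+ i] of the available [(2 * l) ^+ i], and the saved factors [2^-1 ^+ i] sum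
   to less than 1. As [1 + b - t >= 1], its exponent [n.+1 - i] may be raised to [n]. *)
apply: (@le_trans _ _ (\sum_(1 <= i < n.+2)
    (n.+1%:R * ((2 * l) ^+ n.+1 * (1 + b - t) ^+ n)) * 2^-1 ^+ i)); last first.
  rewrite -big_distrr/= sum_half.
  rewrite [leRHS](_ : _ = n.+1%:R * ((2 * l) ^+ n.+1 * (1 + b - t) ^+ n));
    last by ring.
  by rewrite ler_piMr ?mulr_ge0 ?exprn_ge0// gerBl exprn_ge0.
rewrite big_nat [leRHS]big_nat; apply: ler_sum => i /andP[i1 iN].
rewrite !normcM normc_natr -mulrA; apply: ler_pM; rewrite ?mulr_ge0 ?normc_ge0//.
  by rewrite ler_nat; clear -i1 iN; lia.
have niN : (n.+1 - i < n.+1)%N by clear -i1 iN; lia.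
apply: (le_trans (ler_pM (normc_ge0 _) (normc_ge0 _) (at_ _ i1) (IH _ niN _ tI))).
have -> : (2 * l) ^+ n.+1 * (1 + b - t) ^+ n * 2^-1 ^+ i =
  l ^+ i * ((2 * l) ^+ (n.+1 - i) * (1 + b - t) ^+ n).
  have {1}-> : n.+1 = (i + (n.+1 - i))%N by clear -i1 iN; lia.
  rewrite exprD [(2 * l) ^+ i]exprMn exprVn; field.
  by rewrite expf_neq0.
rewrite ler_wpM2l ?exprn_ge0 ?(ltW l0)// ler_wpM2l ?exprn_ge0//.
by rewrite ler_weXn2l//; clear -i1; lia.
Qed.

Lemma normc_transport_coef_le n x : x \in `[0, b] ->
  normc (transport_coef a n x) <= (2 * l * (1 + b)) ^+ n.
Proof.
move=> xI; have /andP[x0 xb] : 0 <= x <= b by move: xI; rewrite in_itv.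
apply: (le_trans (normc_transport_coef n xI)).
rewrite [leRHS]exprMn ler_wpM2l ?exprn_ge0 ?mulr_ge0 ?(ltW l0)//.
by apply: lerXn2r; rewrite ?nnegrE; lra.
Qed.

End transport_bound.

(** * Small solutions *)

Lemma sum_geometric_le (R : realType) (q : R) K n : 0 <= q -> 2 * q <= 1 ->
  \sum_(K <= i < n) q ^+ i.+1 <= 2 * q ^+ K.+1.
Proof.
move=> q0 q2.
have [nK|] := leqP n K; first by rewrite big_geq// mulr_ge0// exprn_ge0.
move=> /ltnW Kn.
(* Subtracting the bound of the remaining tail makes the induction close. *)
suff H : \sum_(K <= i < n) q ^+ i.+1 <= 2 * q ^+ K.+1 - 2 * q ^+ n.+1.
  by rewrite (le_trans H)// gerBl mulr_ge0// exprn_ge0.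
rewrite -(subnKC Kn); elim: (n - K)%N => [|m IH].
  by rewrite addn0 big_geq// subrr.
rewrite addnS big_nat_recr ?leq_addr//=.
apply: (le_trans (lerD IH (lexx _))); rewrite [q ^+ (K + m).+2]exprS.
have : 2 * q * q ^+ (K + m).+1 <= 1 * q ^+ (K + m).+1.
  by rewrite ler_wpM2r// exprn_ge0.
by move: (q ^+ (K + m).+1) (q ^+ K.+1) => s t; rewrite -mulrA; lra.
Qed.

Section power_series_tail.
Context (R : realType) (B d q : R).
Context (B0 : 0 <= B) (d0 : 0 <= d) (Bdq : B * d = q) (q2 : 2 * q <= 1).

Lemma normc_term_le (c z : R[i]) i : normc c <= B ^+ i.+1 -> normc z <= d ->
  normc (c * z ^+ i.+2) <= d * q ^+ i.+1.
Proof.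
move=> cB zd; rewrite normcM normcX.
have -> : d * q ^+ i.+1 = B ^+ i.+1 * d ^+ i.+2.
  by rewrite -Bdq exprMn [d ^+ i.+2]exprS; ring.
by apply: ler_pM => //; rewrite ?exprn_ge0 ?normc_ge0// lerXn2r// nnegrE normc_ge0.
Qed.

(** [K = 0] bounds the whole right-hand side of the equation; [K = N - m] bounds what is left in the
    truncated transport identity. *)
Lemma series_tail (al : nat -> R[i]) (z w : R[i]) K :
  (forall i, (0 < i)%N -> normc (al i) <= B ^+ i) -> normc z <= d ->
  series (fun i => al i.+1 * z ^+ i.+2) @ \oo --> (w : R[i]^o) ->
  normc (w - \sum_(0 <= i < K) al i.+1 * z ^+ i.+2) <= 2 * d * q ^+ K.+1.
Proof.
move=> alB zd zw; apply: (cvg_normc_le zw); exists K => // n /= Kn.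
rewrite seriesEnat/= (big_cat_nat _ Kn)//= [X in normc X]addrC addKr.
apply: (le_trans (ler_normc_sum _ _ _)).
apply: (@le_trans _ _ (\sum_(K <= i < n) d * q ^+ i.+1)).
  by apply: ler_sum => i _; apply: normc_term_le => //; exact: alB.
rewrite -big_distrr/= -mulrA mulrCA ler_wpM2l//.
by apply: sum_geometric_le; rewrite // -Bdq mulr_ge0.
Qed.

End power_series_tail.

(** Both sides run over the pairs with [i >= 1] and [m + i <= N], grouped by [m + i] on the left and
    by [m] on the right. *)
Lemma sum_triangle (V : nmodType) (F : nat -> nat -> V) N :
  \sum_(0 <= n < N.+1) \sum_(1 <= i < n.+1) F (n - i)%N i =
  \sum_(0 <= m < N.+1) \sum_(0 <= i < N - m) F m i.+1.
Proof.
elim: N => [|N IH]; first by rewrite !big_nat1 big_geq// big_geq.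
rewrite big_nat_recr//= IH [RHS]big_nat_recr//= subnn.
rewrite [in RHS](@big_geq _ _ _ 0 0)// addr0.
rewrite [X in _ + X](_ : _ = \sum_(0 <= m < N.+1) F m (N - m).+1).
  rewrite -big_split/=; apply: eq_big_nat => m /andP[_ mN].
  by rewrite subSn// big_nat_recr.
rewrite big_add1/= big_nat_rev/= add0n; apply: eq_big_nat => m /andP[_ mN].
by rewrite subSS subSS; congr (F _ _); lia.
Qed.

Section solutions.
Context (R : realType) (a : nat -> R -> R[i]).
Local Notation mu := (@lebesgue_measure R).
Local Notation b := (2 * pi).
Context (l : R) (l0 : 0 < l).
Context (ma : forall i, (0 < i)%N -> measurable_itv_fun b (a i)).
Context (al : {ae mu, forall x, forall i, (0 < i)%N -> normc (a i x) <= l ^+ i}).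

(* [growth ^+ n] bounds both [a n] and [transport_coef a n]; on the disc of radius
   [small_radius] the terms of the equation then decay like [decay ^+ n], where
   16 leaves room for the contraction and bootstrap estimates over [[0, b]]. *)
Definition growth := 2 * l * (1 + b) : R.
Definition decay := (16 * (1 + b))^-1 : R.
Definition small_radius := decay / growth.

Local Notation B := growth.
Local Notation q := decay.
Local Notation d := small_radius.

Let b0 : 0 <= b :> R. Proof. exact: twopi_ge0. Qed.

Lemma growth_gt0 : 0 < B.
Proof.
by rewrite /growth; apply: mulr_gt0; rewrite ?mulr_gt0//; have := b0; lra.
Qed.

Lemma le_growth : l <= B.
Proof. by rewrite /growth mulrAC ler_peMl ?(ltW l0)//; have := b0; lra. Qed.

Lemma decay_gt0 : 0 < q.
Proof. by rewrite invr_gt0; have := b0; lra. Qed.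

Lemma decayE : 16 * (1 + b) * q = 1.
Proof. by rewrite mulfV// gt_eqF//; have := b0; lra. Qed.

Lemma decay_le : 16 * q <= 1.
Proof. by have := decayE; have := mulr_ge0 b0 (ltW decay_gt0); lra. Qed.

Lemma decay_length_le : 16 * b * q <= 1.
Proof. by have := decayE; have := decay_gt0; lra. Qed.

Lemma small_radius_gt0 : 0 < d.
Proof. by rewrite divr_gt0 ?decay_gt0 ?growth_gt0. Qed.

Lemma growth_small_radius : B * d = q.
Proof. by rewrite mulrC mulfVK// gt_eqF// growth_gt0. Qed.

Lemma ae_coef_le :
  {ae mu, forall x, forall i, (0 < i)%N -> normc (a i x) <= B ^+ i}.
Proof.
apply: lebesgue_aeS al => x ax i i0; apply: (le_trans (ax _ i0)).
by rewrite lerXn2r ?nnegrE ?(ltW l0) ?(ltW growth_gt0)// le_growth.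
Qed.

Let B0 := ltW growth_gt0.
Let d0 := ltW small_radius_gt0.
Let q2 : 2 * q <= 1.
Proof. by have := decay_le; have := decay_gt0; lra. Qed.

Context (v w : R -> R[i]) (vw : lip_diff b v w).
Context (vs : {ae mu, forall x, x \in `]0, b[ ->
  series (fun i => a i.+1 x * v x ^+ i.+2) @ \oo --> (w x : R[i]^o)}).

(** A bootstrap: while [v] is bounded by [d], its slope is at most [2 * d * q], so over [[0, b]] it
    moves by at most [d / 4] and stays below [3 / 4 * d]. The Lipschitz bound then keeps it below
    [d] a little further, and [real_induction] concludes. *)
Lemma small_solution : normc (v 0) <= d / 2 ->
  forall x, x \in `[0, b] -> normc (v x) <= d.
Proof.
move=> v0 x; rewrite in_itv/=; move: x.
have d1 := small_radius_gt0.
have strict x : 0 <= x -> x <= b ->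
    (forall y, 0 <= y < x -> normc (v y) <= d) -> normc (v x) <= 3 / 4 * d.
  move=> x0 xb vd.
  have : normc (v x - v 0) <= 2 * d * q * (x - 0).
    apply: (lip_diff_mean_value b0 vw (lexx 0) x0 xb).
    apply: lebesgue_aeS2 ae_coef_le vs => t at_ vt /andP[t0 tx].
    have tI : t \in `]0, b[ by rewrite in_itv/= t0 (lt_le_trans tx).
    have td : normc (v t) <= d by apply: vd; rewrite tx ltW.
    have := series_tail B0 d0 growth_small_radius q2 0 at_ td (vt tI).
    by rewrite big_geq// subr0 expr1.
  have : 2 * d * q * (x - 0) <= d / 4.
    rewrite subr0; apply: (@le_trans _ _ (2 * d * q * b)).
      by apply: ler_wpM2l => //; rewrite mulr_ge0 ?(ltW decay_gt0)// mulr_ge0.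
    have := ler_wpM2l d0 decay_length_le; rewrite mulr1.
    have -> : 2 * d * q * b = d * (16 * b * q) / 8 by field.
    lra.
  have := ler_normcD (v x - v 0) (v 0); rewrite subrK.
  by move: (normc _) (normc _) (normc _) v0 => ? ? ?; lra.
move: (vw) => [[L L0 vL] _].
apply: real_induction.
- by move: v0; lra.
- move=> x /andP[x0 xb] vd.
  have vx : normc (v x) <= 3 / 4 * d.
    apply: strict => //; first exact: ltW.
    by move=> y /andP[y0 /ltW yx]; apply: vd; rewrite y0.
  have L1 : 0 < 4 * (L + 1) by lra.
  exists (d / (4 * (L + 1))); first by rewrite divr_gt0.
  move=> y /andP[xy yd] yb.
  have xI : x \in `[0, b] by rewrite in_itv/= x0 ltW.
  have yI : y \in `[0, b] by rewrite in_itv/= yb (le_trans x0)// ltW.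
  have := ler_normcD (v y - v x) (v x); rewrite subrK => vyx.
  have := vL _ _ yI xI; rewrite gtr0_norm ?subr_gt0// => vL'.
  have : L * (y - x) <= d / 4.
    have yx : y - x <= d / (4 * (L + 1)) by rewrite lerBlDl ltW.
    apply: le_trans (ler_wpM2l L0 yx) _.
    have -> : d / 4 = (L + 1) * (d / (4 * (L + 1))) by field; rewrite gt_eqF; lra.
    by rewrite ler_wpM2r ?lerDl// divr_ge0// ltW.
  by move: vyx vL' vx; move: (normc _) (normc _) (normc _) (L * _) => ? ? ? ?; lra.
- move=> x /andP[x0 xb] vd.
  by have := strict x (ltW x0) xb vd; move: d1 (normc _) => ? ?; lra.
Qed.

(* The truncation of [\sum_n transport_coef n x * v x ^+ n.+1] at order [N] is
   constant in [x] up to the tail of the equation: all other terms of its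
   derivative cancel. *)
Lemma transport_solution N : (forall x, x \in `[0, b] -> normc (v x) <= d) ->
  normc (v b - \sum_(0 <= n < N.+1) transport_coef a n 0 * v 0 ^+ n.+1) <=
  2 * d * 2^-1 ^+ N * b.
Proof.
move=> vd; pose C := transport_coef a.
pose D n x := - \sum_(1 <= i < n.+1) (n - i + 1)%:R * (a i x * C (n - i)%N x).
have CD n : lip_diff b (C n) (D n).
  case: n => [|n]; last exact: lip_diff_transport_coef l0 ma al n.
  have -> : C 0%N = cst 1 by apply/funext => x; exact: transport_coef0.
  have -> : D 0%N = cst 0 by apply/funext => x; rewrite /D big_geq// oppr0.
  exact: lip_diff_cst.
pose G x := \sum_(n <- index_iota 0 N.+1) C n x * v x ^+ n.+1.
pose G' x := \sum_(n <- index_iota 0 N.+1)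
  (D n x * v x ^+ n.+1 + C n x * (n.+1%:R * v x ^+ n * w x)).
have GG' : lip_diff b G G'.
  by apply: lip_diff_sum => n _; exact: (lip_diffM b0 (CD n) (lip_diffX b0 n vw)).
have <- : G b = v b.
  rewrite /G big_ltn// /C transport_coef0 mul1r expr1 big_nat big1 ?addr0//.
  by move=> [|n] // _; rewrite transport_coef_end mul0r.
suff H : normc (G b - G 0) <= 2 * d * 2^-1 ^+ N * (b - 0).
  by rewrite subr0 in H.
apply: (lip_diff_mean_value b0 GG' (lexx 0) b0 (lexx b)).
have Cb := normc_transport_coef_le l0 ma al.
apply: lebesgue_aeS2 ae_coef_le vs => t at_ vt /andP[t0 tb].
have tI' : t \in `]0, b[ by rewrite in_itv/= t0 tb.
have tI : t \in `[0, b] by rewrite in_itv/= !ltW.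
have {vt} := vt tI'; have {}vd := vd t tI.
set z := v t in vd *; set u := w t => vt.
(* Grouping the terms of [D n] by the index [m = n - i] of the coefficient they contain pairs them
   with the term of [w] that carries [C m]. *)
have -> : G' t = \sum_(0 <= m < N.+1) (m.+1%:R * C m t * z ^+ m *
    (u - \sum_(0 <= i < N - m) a i.+1 t * z ^+ i.+2)).
  have tri := sum_triangle
    (fun m i => (m + 1)%:R * (a i t * C m t) * z ^+ (m + i).+1) N.
  rewrite /G' big_split/=.
  rewrite [X in X + _](_ : _ = - \sum_(0 <= n < N.+1) \sum_(1 <= i < n.+1)
    (n - i + 1)%:R * (a i t * C (n - i)%N t) * z ^+ (n - i + i).+1); last first.
    rewrite -sumrN; apply: eq_bigr => n _.
    rewrite /D mulNr big_distrl/=; congr (- _).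
    by apply: eq_big_nat => i /andP[_ iN]; rewrite subnK.
  rewrite tri addrC -sumrB; apply: eq_bigr => m _.
  rewrite mulrBr; congr (_ - _).
    by rewrite -/z -/u; ring.
  rewrite big_distrr/=; apply: eq_bigr => i _.
  have -> : (m + i.+1).+1 = (m + i.+2)%N by rewrite -addnS.
  by rewrite exprD addn1; ring.
apply: (le_trans (ler_normc_sum _ _ _)).
have qp := decay_gt0.
(* The bound [B ^+ m * d ^+ m = q ^+ m] completes the tail's [q ^+ (N - m).+1] to a power of [q]
   independent of [m]. *)
have H m : (m < N.+1)%N -> normc (m.+1%:R * C m t * z ^+ m *
    (u - \sum_(0 <= i < N - m) a i.+1 t * z ^+ i.+2)) <=
    N.+1%:R * (2 * d * q ^+ N.+1).
  move=> mN; rewrite !normcM normc_natr normcX.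
  have -> : N.+1%:R * (2 * d * q ^+ N.+1) =
    N.+1%:R * B ^+ m * d ^+ m * (2 * d * q ^+ (N - m).+1) :> R.
    have -> : q ^+ N.+1 = B ^+ m * d ^+ m * q ^+ (N - m).+1.
      rewrite -exprMn growth_small_radius -exprD; congr (_ ^+ _).
      by clear -mN; lia.
    by ring.
  apply: ler_pM; rewrite ?mulr_ge0 ?exprn_ge0 ?normc_ge0//; last first.
    exact: (series_tail B0 d0 growth_small_radius q2 _ at_ vd vt).
  apply: ler_pM; rewrite ?mulr_ge0 ?exprn_ge0 ?normc_ge0//; last first.
    by rewrite lerXn2r// nnegrE normc_ge0.
  apply: ler_pM; rewrite ?normc_ge0//; first by rewrite ler_nat.
  exact: Cb.
rewrite big_nat; apply: (@le_trans _ _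
  (\sum_(0 <= m < N.+1) N.+1%:R * (2 * d * q ^+ N.+1))).
  by rewrite [leRHS]big_nat; apply: ler_sum => m /andP[_ mN]; exact: H.
rewrite sumr_const_nat subn0 -[X in X <= _]mulr_natl.
(* The number of terms and the weights [m.+1] cost the square of [N.+1], at most [4 ^+ N]; this is
   affordable because [4 * q <= 1 / 2]. *)
have N2 : N.+1%:R <= 2 ^+ N :> R.
  by rewrite -natrX ler_nat; exact: ltn_expl.
have -> : N.+1%:R * (N.+1%:R * (2 * d * q ^+ N.+1)) =
  2 * d * (N.+1%:R * N.+1%:R * q ^+ N.+1) :> R by ring.
apply: ler_wpM2l; first by rewrite mulr_ge0.
apply: (@le_trans _ _ (2 ^+ N * 2 ^+ N * q ^+ N)).
  rewrite exprSr mulrA -[leRHS]mulr1.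
  apply: ler_pM; rewrite ?mulr_ge0 ?exprn_ge0 ?(ltW qp)//.
    apply: ler_pM; rewrite ?mulr_ge0 ?exprn_ge0 ?(ltW qp)//.
    by apply: ler_pM.
  by have := decay_le; lra.
have q8 : 2 * 2 * q <= 2^-1 by have := decay_le; lra.
rewrite -!exprMn; apply: lerXn2r => //; rewrite nnegrE ?invr_ge0//.
by rewrite mulr_ge0 ?(ltW qp).
Qed.

End solutions.

(** * Existence by Picard iteration *)

Section complex_sequences.
Context (R : realType).

Lemma norm_half_lt1 : `|2^-1 : R| < 1.
Proof. by rewrite ger0_norm ?invr_ge0// invf_lt1 ?ltr1n. Qed.

Lemma near_half_lt (c e : R) : 0 < e -> \forall n \near \oo, c * 2^-1 ^+ n < e.
Proof.
move=> e0; have h1 := norm_half_lt1.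
have /cvgrPdist_lt /(_ _ e0) := @cvg_geometric R c _ h1.
apply: filterS => n; rewrite sub0r normrN /geometric/= => /le_lt_trans; apply.
exact: ler_norm.
Qed.

Lemma cvg_fast_real (u : nat -> R) (C : R) :
  (forall k, `|u k.+1 - u k| <= C * 2^-1 ^+ k) -> cvgn u.
Proof.
move=> uC; have h1 := norm_half_lt1.
have : cvgn (series (telescope u)).
  apply: normed_cvg; apply: (@series_le_cvg _ _ (geometric C 2^-1)) => //.
  - by move=> n; exact: normr_ge0.
  - by move=> n; exact: le_trans (normr_ge0 _) (uC n).
  - exact: is_cvg_geometric_series.
move=> tu; have -> : u = (fun n => u 0%N + series (telescope u) n).
  by apply/funext => n; rewrite [LHS]eq_sum_telescope.
by apply: is_cvgD => //; exact: is_cvg_cst.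
Qed.

(** The limit is named through its two real components so that measurability of a limit of functions
    can be read off componentwise. *)
Lemma cvg_fast (u : nat -> R[i]) (C : R) :
  (forall k, normc (u k.+1 - u k) <= C * 2^-1 ^+ k) ->
  u @ \oo --> ((limn (fun k => complex.Re (u k)) +i*
                limn (fun k => complex.Im (u k)))%C : R[i]^o).
Proof.
move=> uC.
have cRe : cvgn (fun k => complex.Re (u k)).
  apply: (@cvg_fast_real _ C) => k; rewrite -ReB.
  exact: le_trans (normRe_le_normc _) (uC k).
have cIm : cvgn (fun k => complex.Im (u k)).
  apply: (@cvg_fast_real _ C) => k; rewrite -ImB.
  exact: le_trans (normIm_le_normc _) (uC k).
apply/cvg_normcP => e e0; have e2 : 0 < e / 2 by rewrite divr_gt0.
move/cvgrPdist_lt : cRe => /(_ _ e2) cRe; move/cvgrPdist_lt : cIm => /(_ _ e2) cIm.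
near=> n; apply: le_lt_trans (normc_le_ReIm _) _; rewrite ReB ImB (splitr e)/=.
by apply: ltrD; rewrite distrC; near: n.
Unshelve. all: by end_near. Qed.

Lemma cvg_fast_dist (u : nat -> R[i]) (L : R[i]) (C : R) : 0 <= C ->
  (forall k, normc (u k.+1 - u k) <= C * 2^-1 ^+ k) ->
  u @ \oo --> (L : R[i]^o) ->
  forall k, normc (L - u k) <= 2 * C * 2^-1 ^+ k.
Proof.
move=> C0 uC uL k; apply: (cvg_normc_le uL); exists k => // n /= kn.
suff H m : normc (u (k + m)%N - u k) <=
    2 * C * 2^-1 ^+ k - 2 * C * 2^-1 ^+ (k + m).
  rewrite -(subnKC kn); apply: le_trans (H _) _.
  by rewrite gerBl !mulr_ge0// exprn_ge0// invr_ge0.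
elim: m => [|m IH]; first by rewrite addn0 !subrr normc0.
have -> : u (k + m.+1)%N - u k =
  (u (k + m).+1 - u (k + m)%N) + (u (k + m)%N - u k) by rewrite addnS; ring.
apply: (le_trans (ler_normcD _ _)); apply: (le_trans (lerD (uC _) IH)).
rewrite addnS [2^-1 ^+ (k + m).+1]exprS le_eqVlt; apply/orP; left.
by apply/eqP; field.
Qed.

(** The squared form is polynomial in the components, hence a measurable condition; it is the test
    used in [bounded_coef]. *)
Lemma normc_leE (z : R[i]) (K : R) : 0 <= K ->
  (normc z <= K) = (complex.Re z ^+ 2 + complex.Im z ^+ 2 <= K ^+ 2).
Proof.
move=> K0; rewrite -(@ler_pXn2r _ 2%N)// ?nnegrE ?normc_ge0//.
by case: z => x y /=; rewrite sqr_sqrtr// addr_ge0 ?sqr_ge0.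
Qed.

Lemma normc_subXX (x y : R[i]) (d : R) n : normc x <= d -> normc y <= d ->
  normc (x ^+ n.+1 - y ^+ n.+1) <= n.+1%:R * d ^+ n * normc (x - y).
Proof.
move=> xd yd; have d0 : 0 <= d := le_trans (normc_ge0 _) xd.
rewrite subrXX normcM mulrC ler_wpM2r ?normc_ge0//.
apply: (le_trans (ler_normc_sum _ _ _)).
apply: (@le_trans _ _ (\sum_(i < n.+1) d ^+ n)); last first.
  by rewrite sumr_const card_ord mulr_natl.
apply: ler_sum => i _; rewrite normcM !normcX.
have -> : d ^+ n = d ^+ (n.+1.-1 - i) * d ^+ i.
  by rewrite -exprD subnK// -ltnS ltn_ord.
by apply: ler_pM; rewrite ?exprn_ge0 ?normc_ge0// lerXn2r// nnegrE normc_ge0.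
Qed.

End complex_sequences.

Section existence.
Context (R : realType) (a : nat -> R -> R[i]).
Local Notation mu := (@lebesgue_measure R).
Local Notation b := (2 * pi).
Context (l : R) (l0 : 0 < l).
Context (ma : forall i, (0 < i)%N -> measurable_itv_fun b (a i)).
Context (al : {ae mu, forall x, forall i, (0 < i)%N -> normc (a i x) <= l ^+ i}).
Local Notation B := (growth l).
Local Notation q := (decay R).
Local Notation d := (small_radius l).
Context (r : R[i]) (rd : normc r <= d / 2).

Let b0 : 0 <= b :> R. Proof. exact: twopi_ge0. Qed.
Let B0 : 0 <= B. Proof. exact/ltW/growth_gt0. Qed.
Let d0 : 0 <= d. Proof. exact/ltW/small_radius_gt0. Qed.
Let Bdq : B * d = q. Proof. exact: growth_small_radius. Qed.
Let q0 : 0 < q. Proof. exact: decay_gt0. Qed.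
Let q16 : 16 * q <= 1. Proof. exact: decay_le. Qed.
Let qb16 : 16 * b * q <= 1. Proof. exact: decay_length_le. Qed.
Let q2 : 2 * q <= 1. Proof. by have := q16; have := q0; lra. Qed.
Let q4 : 2 * (2 * q) <= 1. Proof. by have := q16; have := q0; lra. Qed.

(** This is [r] plus the integral of [g] over [[0, x]], written as a difference because
    [lip_diff_integral] treats a moving lower endpoint. *)
Definition primitive (g : R -> R[i]) (x : R) : R[i] :=
  r + (complex_integral [set` `[0, b]] g - complex_integral [set` `[x, b]] g).

(** [2 * d * q] bounds the right-hand side of the equation on the disc of radius [d]. *)
Definition admissible (g : R -> R[i]) := measurable_itv_fun b g /\
  (forall t, t \in `[0, b] -> normc (g t) <= 2 * d * q).

Lemma primitive0 g : primitive g 0 = r.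
Proof. by rewrite /primitive subrr addr0. Qed.

Lemma lip_diff_primitive g : admissible g -> lip_diff b (primitive g) g.
Proof.
move=> [mg gd]; have K0 : 0 <= 2 * d * q by rewrite mulr_ge0 ?(ltW q0)// mulr_ge0.
have gae : {ae mu, forall t, t \in `[0, b] -> normc (g t) <= 2 * d * q}.
  exact: aeW.
have := lip_diffB b0 (lip_diff_cst b (r + complex_integral [set` `[0, b]] g))
  (lip_diff_integral K0 mg gae).
congr (lip_diff b _ _); apply/funext => x /=.
  by rewrite /primitive addrA.
by rewrite sub0r opprK.
Qed.

Lemma primitive_dist g h e : admissible g -> admissible h ->
  (forall t, t \in `[0, b] -> normc (g t - h t) <= e) ->
  forall x, x \in `[0, b] -> normc (primitive g x - primitive h x) <= e * b.
Proof.
move=> ag ah ghe x xI; have /andP[x0 xb] : 0 <= x <= b by move: xI; rewrite in_itv.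
have e0 : 0 <= e by apply: le_trans (ghe x xI); exact: normc_ge0.
have gh := lip_diffB b0 (lip_diff_primitive ag) (lip_diff_primitive ah).
have := @lip_diff_mean_value _ _ _ _ e 0 x b0 gh (lexx _) x0 xb.
rewrite !primitive0 subrr !subr0 => H; apply: le_trans (H _) _.
  apply: aeW => t /andP[t0 tx]; apply: ghe.
  by rewrite in_itv/= ltW// ltW// (lt_le_trans tx).
by rewrite ler_wpM2l.
Qed.

Lemma normc_primitive_le g : admissible g ->
  forall x, x \in `[0, b] -> normc (primitive g x) <= d.
Proof.
move=> ag x xI.
(* Comparison with the zero slope, whose primitive is constantly [r]: the distance is at most
   [d / 8], and [r] contributes [d / 2]. *)
have a0 : admissible (cst 0).
  split; first exact: measurable_itv_cst.
  by move=> t _; rewrite normc0 mulr_ge0 ?(ltW q0)// mulr_ge0.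
have := primitive_dist ag a0 _ xI => /(_ (2 * d * q)).
have -> : primitive (cst 0) x = r.
  rewrite /primitive /complex_integral/=.
  by rewrite !(Rintegral_cst, mul0r)// subrr addr0.
move=> H; have {}H : normc (primitive g x - r) <= 2 * d * q * b.
  by apply: H => t tI; rewrite subr0; exact: ag.2.
rewrite -(subrK r (primitive g x)); apply: le_trans (ler_normcD _ _) _.
apply: le_trans (lerD H rd) _.
have := ler_wpM2l d0 qb16; rewrite mulr1.
have -> : 2 * d * q * b = d * (16 * b * q) / 8 by field.
by have := d0; lra.
Qed.

(* The coefficients are changed on a null set so as to be bounded everywhere. *)
Definition bounded_coef (i : nat) (t : R) : R[i] :=
  if complex.Re (a i t) ^+ 2 + complex.Im (a i t) ^+ 2 <= (B ^+ i) ^+ 2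
  then a i t else 0.

Lemma normc_bounded_coef i t : normc (bounded_coef i t) <= B ^+ i.
Proof.
rewrite /bounded_coef -normc_leE ?exprn_ge0//; case: ifPn => // _.
by rewrite normc0 exprn_ge0.
Qed.

Lemma measurable_bounded_coef i : (0 < i)%N ->
  measurable_itv_fun b (bounded_coef i).
Proof.
move=> i0; have [mRe mIm] := ma i0.
have mc : measurable_fun [set` `[0, b]] (fun t =>
    complex.Re (a i t) ^+ 2 + complex.Im (a i t) ^+ 2 <= (B ^+ i) ^+ 2).
  by apply: measurable_fun_ler => //; apply: measurable_funD; exact: measurable_funX.
have H (f : R[i] -> R) : f 0 = 0 ->
    measurable_fun [set` `[0, b]] (fun t => f (a i t)) ->
    measurable_fun [set` `[0, b]] (fun t => f (bounded_coef i t)).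
  move=> f0 mf; rewrite /bounded_coef.
  under [X in measurable_fun _ X]eq_fun do rewrite (fun_if f) f0.
  apply: measurable_fun_if => //; first exact: measurable_funS mf.
by split; apply: H.
Qed.

Definition vector_field (k : nat) (v : R -> R[i]) (t : R) : R[i] :=
  \sum_(0 <= i < k) bounded_coef i.+1 t * v t ^+ i.+2.

Lemma vector_field_admissible k v : lipschitz_itv b v ->
  (forall t, t \in `[0, b] -> normc (v t) <= d) ->
  admissible (vector_field k v).
Proof.
move=> vl vd; split.
  apply: measurable_itv_sum => i; apply: measurable_itvM.
    exact: measurable_bounded_coef.
  by apply: measurable_itvX; exact: lipschitz_itv_measurable.
move=> t tI; apply: (le_trans (ler_normc_sum _ _ _)).
apply: (@le_trans _ _ (\sum_(0 <= i < k) d * q ^+ i.+1)).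
  apply: ler_sum => i _; apply: (normc_term_le d0 Bdq) => //; last exact: vd.
  exact: normc_bounded_coef.
rewrite -big_distrr/= -mulrA mulrCA ler_wpM2l//.
by apply: sum_geometric_le; rewrite // ltW.
Qed.

(** Differences of powers cost a factor [i.+2 <= 2 ^ i.+1], which only replaces [q] by [2 * q] in
    the geometric sum. *)
Lemma vector_field_lipschitz k u v t : normc (u t) <= d -> normc (v t) <= d ->
  normc (vector_field k u t - vector_field k v t) <= 4 * q * normc (u t - v t).
Proof.
move=> ud vd; rewrite /vector_field -sumrB.
apply: (le_trans (ler_normc_sum _ _ _)).
apply: (@le_trans _ _ (\sum_(0 <= i < k) (2 * q) ^+ i.+1 * normc (u t - v t))).
  apply: ler_sum => i _; rewrite -mulrBr normcM.
  apply: (le_trans (ler_pM (normc_ge0 _) (normc_ge0 _) (normc_bounded_coef _ _)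
    (normc_subXX _ ud vd))).
  rewrite mulrA ler_wpM2r ?normc_ge0//.
  have -> : B ^+ i.+1 * (i.+2%:R * d ^+ i.+1) = i.+2%:R * q ^+ i.+1.
    by rewrite mulrCA -exprMn Bdq.
  rewrite exprMn ler_wpM2r ?exprn_ge0 ?(ltW q0)//.
  by rewrite -natrX ler_nat ltn_expl.
rewrite -big_distrl/= ler_wpM2r ?normc_ge0//.
have := @sum_geometric_le _ (2 * q) 0 k _ q4.
by rewrite expr1 mulr_ge0 ?(ltW q0)// => /(_ isT); lra.
Qed.

(* Picard iteration, truncating the equation to degree [k + 1] at step [k] so
   that each step involves a finite sum. *)
Fixpoint picard (k : nat) : R -> R[i] :=
  if k is k'.+1 then primitive (vector_field k' (picard k')) else cst r.

Lemma picard_invariant k : lipschitz_itv b (picard k) /\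
  (forall t, t \in `[0, b] -> normc (picard k t) <= d).
Proof.
elim: k => [|k [kl kd]] /=.
  split; first exact: (lip_diff_cst b r).1.
  by move=> t _; apply: (le_trans rd); have := d0; lra.
have ak := vector_field_admissible k kl kd.
by split; [exact: (lip_diff_primitive ak).1|exact: normc_primitive_le].
Qed.

Local Notation slope k := (vector_field k (picard k)).

Lemma slope_admissible k : admissible (slope k).
Proof. by have [kl kd] := picard_invariant k; exact: vector_field_admissible. Qed.

(** A step adds one new term, at most [d * 2^-1 ^+ k.+2], and moves the old ones by the previous
    distance times [4 * q * b <= 1 / 4]. The two quarters add up to the required half. *)
Lemma slope_dist k t : t \in `[0, b] ->
  normc (slope k.+1 t - slope k t) <= d * 2^-1 ^+ k.
Proof.
have pd j s (sI : s \in `[0, b]) : normc (picard j s) <= d :=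
  (picard_invariant j).2 s sI.
have qh j : q ^+ j <= 2^-1 ^+ j.
  have q2' : q <= 2^-1 by have := q2; lra.
  by apply: lerXn2r => //; rewrite nnegrE; [exact: ltW q0|rewrite invr_ge0].
elim: k t => [|k IH] t tI.
  rewrite /vector_field big_nat1 big_geq// subr0 expr0 mulr1.
  apply: (le_trans (normc_term_le d0 Bdq (normc_bounded_coef _ _) (pd _ _ tI))).
  by rewrite expr1 ler_piMr//; have := q2; have := q0; lra.
have -> : slope k.+2 t - slope k.+1 t =
    bounded_coef k.+2 t * picard k.+2 t ^+ k.+3 +
    (vector_field k.+1 (picard k.+2) t - vector_field k.+1 (picard k.+1) t).
  by rewrite /vector_field [in LHS]big_nat_recr//=; ring.
apply: (le_trans (ler_normcD _ _)).
have H1 := normc_term_le d0 Bdq (normc_bounded_coef k.+2 t) (pd k.+2 _ tI).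
have H2 := vector_field_lipschitz k.+1 (pd k.+2 _ tI) (pd k.+1 _ tI).
have H3 := primitive_dist (slope_admissible k.+1) (slope_admissible k) IH tI.
apply: (le_trans (lerD H1 (le_trans H2 (ler_wpM2l _ H3)))).
  by rewrite mulr_ge0 ?(ltW q0).
have -> : 4 * q * (d * 2^-1 ^+ k * b) = d * (2^-1 ^+ k / 4 * (16 * b * q)) by field.
rewrite -mulrDr ler_wpM2l//.
apply: (@le_trans _ _ (2^-1 ^+ k.+2 + 2^-1 ^+ k / 4 * 1)).
  by rewrite lerD// ler_wpM2l// mulr_ge0 ?invr_ge0// exprn_ge0// invr_ge0.
by rewrite !exprS le_eqVlt; apply/orP; left; apply/eqP; field.
Qed.

Lemma solution_exists : exists v, is_solution a r v.
Proof.
pose g t := ((limn (fun k => complex.Re (slope k t)) +i*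
              limn (fun k => complex.Im (slope k t)))%C : R[i]).
have gcvg t : t \in `[0, b] -> (fun k => slope k t) @ \oo --> (g t : R[i]^o).
  by move=> tI; apply: cvg_fast => k; exact: slope_dist.
have ag : admissible g.
  split; last first.
    move=> t tI; rewrite -[g t]subr0; apply: (cvg_normc_le (gcvg t tI)).
    by apply: nearW => k; rewrite subr0; exact: (slope_admissible k).2.
  split.
    apply: (@measurable_fun_cvg _ _ _ _ (fun k t => complex.Re (slope k t))).
      by move=> k; have [[mRe _] _] := slope_admissible k; exact: mRe.
    move=> t tI; apply: (@cvg_fast_real _ _ d) => k.
    by rewrite -ReB; apply: (le_trans (normRe_le_normc _)); exact: slope_dist.
  apply: (@measurable_fun_cvg _ _ _ _ (fun k t => complex.Im (slope k t))).
    by move=> k; have [[_ mIm] _] := slope_admissible k; exact: mIm.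
  move=> t tI; apply: (@cvg_fast_real _ _ d) => k.
  by rewrite -ImB; apply: (le_trans (normIm_le_normc _)); exact: slope_dist.
pose v := primitive g.
have [vl vg] := lip_diff_primitive ag.
have vd := normc_primitive_le ag.
have gdist k t : t \in `[0, b] -> normc (g t - slope k t) <= 2 * d * 2^-1 ^+ k.
  by move=> tI; apply: (cvg_fast_dist d0 _ (gcvg t tI)) => j; exact: slope_dist.
have sol t : t \in `[0, b] ->
    series (fun i => bounded_coef i.+1 t * v t ^+ i.+2) @ \oo --> (g t : R[i]^o).
  (* [picard n] is the primitive of the slope of index [n.-1], so [n] must be positive. Replacing it
     by [v] in the field costs at most [d * 2^-1 ^+ n], and the slope is within [2 * d * 2^-1 ^+ n]
     of [g]; hence the constant [3 * d] below. *)
  move=> tI; apply/cvg_normcP => e e0; near=> n.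
  have n0 : (0 < n)%N by near: n; exact: nbhs_infty_gt.
  have -> : series (fun i => bounded_coef i.+1 t * v t ^+ i.+2) n - g t =
    (vector_field n v t - slope n t) - (g t - slope n t).
    by rewrite opprB addrA subrK.
  have H1 := gdist n t tI.
  have H2 := vector_field_lipschitz n (vd t tI) ((picard_invariant n).2 t tI).
  have H3 : normc (v t - picard n t) <= 2 * d * 2^-1 ^+ n.-1 * b.
    rewrite -{1}(prednK n0).
    by apply: (primitive_dist ag (slope_admissible _) _ tI) => s; exact: gdist.
  apply: (le_lt_trans (ler_normcB _ _)).
  have q40 : 0 <= 4 * q by rewrite mulr_ge0 ?(ltW q0).
  apply: (le_lt_trans (lerD (le_trans H2 (ler_wpM2l q40 H3)) H1)).
  apply: (@le_lt_trans _ _ (3 * d * 2^-1 ^+ n)); last first.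
    by near: n; exact: near_half_lt.
  have s0 : 0 <= 2^-1 ^+ n.-1 :> R by rewrite exprn_ge0// invr_ge0.
  have sE : 2^-1 ^+ n = 2^-1 * 2^-1 ^+ n.-1 :> R by rewrite -exprS prednK.
  rewrite sE; have := ler_wpM2l (mulr_ge0 d0 s0) qb16.
  by move: (2^-1 ^+ n.-1) => s; lra.
exists v; split.
- move: vl => [L _ vL]; exists L => x y; exact: vL.
- exact: primitive0.
- apply: lebesgue_aeS2 (ae_coef_le l0 al) vg => x ax vx xI.
  exists (g x); split; last exact: vx.
  have xI' : x \in `[0, b].
    by move: xI; rewrite !in_itv/= => /andP[/ltW-> /ltW->].
  rewrite (_ : (fun i => a i.+1 x * v x ^+ i.+2) =
    fun i => bounded_coef i.+1 x * v x ^+ i.+2); first exact: sol.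
  by apply/funext => i; rewrite /bounded_coef -normc_leE ?exprn_ge0// ax.
Unshelve. all: by end_near. Qed.

End existence.

(** * The return map *)

Section power_series_identity.
Context (R : realType).

(** At a small positive real point the first nonzero term would exceed the whole tail after it, so
    the sum could not be [r]. *)
Lemma power_series_eq_id (c : nat -> R[i]) (B rho : R) : 0 < B -> 0 < rho ->
  (forall n, (0 < n)%N -> normc (c n) <= B ^+ n) ->
  (forall r : R[i], normc r < rho ->
    (fun N => r + \sum_(1 <= n < N) c n * r ^+ n.+1) @ \oo --> (r : R[i]^o)) ->
  forall n, (0 < n)%N -> c n = 0.
Proof.
move=> B0 rho0 cB cid; elim/ltn_ind => m IH m0.
apply/ComplexField.Normc.eq0_normc/eqP; rewrite eq_le normc_ge0 andbT leNgt.
apply/negP => cm0; set p := normc (c m) in cm0 *.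
have Bm0 : 0 < 4 * B ^+ m.+1 by rewrite mulr_gt0// exprn_gt0.
(* The three bounds keep [t] in the disc, make the tail geometric with ratio at most [1 / 2], and
   force [2 * t * B ^+ m.+1 < p]. *)
pose t := Num.min (rho / 2) (Num.min (2 * B)^-1 (p / (4 * B ^+ m.+1))).
have t0 : 0 < t by rewrite !lt_min !divr_gt0// invr_gt0 mulr_gt0.
have trho : t < rho.
  rewrite (@le_lt_trans _ _ (rho / 2)) ?ge_min ?lexx//.
  by rewrite ltr_pdivrMr// ltr_pMr// ltr1n.
have tB : 2 * (B * t) <= 1.
  have : t <= (2 * B)^-1 by rewrite !ge_min lexx orbT.
  have B2 : 0 < 2 * B by rewrite mulr_gt0.
  by move=> /(ler_wpM2l (ltW B2)); rewrite mulfV ?gt_eqF// mulrA.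
have tp : t * (4 * B ^+ m.+1) <= p.
  by rewrite -ler_pdivlMr// !ge_min lexx !orbT.
have tn : normc t%:C = t by rewrite normcR gtr0_norm.
have rt : normc t%:C < rho by rewrite tn.
have := @cvg_normc_le _ _ _ (t%:C + c m * t%:C ^+ m.+1)
  (2 * t * (B * t) ^+ m.+1) (cid _ rt).
have -> : t%:C - (t%:C + c m * t%:C ^+ m.+1) = - (c m * t%:C ^+ m.+1).
  by rewrite opprD addrA subrr add0r.
rewrite (normcN (_ : Rcomplex R)) normcM normcX tn -/p.
have H : p * t ^+ m.+1 <= 2 * t * (B * t) ^+ m.+1 -> False.
  rewrite exprMn mulrA ler_pM2r ?exprn_gt0// => pt.
  by have := le_trans tp pt; have := mulr_gt0 t0 Bm0; nra.
move=> /(_ _) K; apply: H; apply: K; exists m.+1 => // N /= mN.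
rewrite (@big_cat_nat _ _ _ m.+1)//= big_nat_recr//= big_nat big1 ?add0r; last first.
  by move=> i /andP[i0 im]; rewrite IH// mul0r.
rewrite [X in normc X](_ : _ = \sum_(m.+1 <= n < N) c n * t%:C ^+ n.+1);
  last by ring.
apply: (le_trans (ler_normc_sum _ _ _)).
apply: (@le_trans _ _ (\sum_(m.+1 <= n < N) t * (B * t) ^+ n)).
  rewrite big_nat [leRHS]big_nat; apply: ler_sum => i /andP[mi _].
  rewrite normcM normcX tn exprS exprMn mulrCA ler_wpM2l ?(ltW t0)//.
  by rewrite ler_wpM2r ?exprn_ge0 ?(ltW t0)// cB// (leq_trans _ mi).
rewrite -big_distrr/= -mulrA mulrCA ler_wpM2l ?(ltW t0)//.
case: N mN => // N _; rewrite big_add1/=.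
by apply: sum_geometric_le => //; rewrite mulr_ge0// ltW.
Qed.

End power_series_identity.

Section return_map.
Context (R : realType) (a : nat -> R -> R[i]).
Local Notation mu := (@lebesgue_measure R).
Local Notation b := (2 * pi).

(** The countably many essential bounds hold simultaneously off a single null set. *)
Lemma coefficient_space_bound : coefficient_space a ->
  exists l : R, [/\ 0 < l,
    forall i, (0 < i)%N -> measurable_itv_fun b (a i) &
    {ae mu, forall x, forall i, (0 < i)%N -> normc (a i x) <= l ^+ i}].
Proof.
move=> [am [l l0 al]]; exists l; split=> //.
  by move=> i /am[mRe mIm _]; split; exact: measurable_funTS.
apply/ae_foralln => i; have [->|i0] := posnP i; first exact: aeW.
(* The norm of exponent [+oo] is the essential supremum once the whole space has positive
   measure. *)
have muT : (0 < mu setT)%E by rewrite -set_itvNyy lebesgue_measure_itv/= ltry.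
have := al i i0; rewrite unlock muT => /ess_supP.
by apply: lebesgue_aeS => x; rewrite /= lee_fin ger0_norm ?normc_ge0.
Qed.

Context (l : R) (l0 : 0 < l).
Context (ma : forall i, (0 < i)%N -> measurable_itv_fun b (a i)).
Context (al : {ae mu, forall x, forall i, (0 < i)%N -> normc (a i x) <= l ^+ i}).

Lemma normc_return_coef_le n : (0 < n)%N ->
  normc (return_coef a n) <= growth l ^+ n.
Proof.
move=> n0; rewrite return_coefE//; apply: normc_transport_coef_le => //.
by rewrite in_itv/= lexx twopi_ge0.
Qed.

Lemma first_return_map_series (r : R[i]) : normc r < small_radius l / 2 ->
  (fun N => r + \sum_(1 <= n < N) return_coef a n * r ^+ n.+1) @ \oo -->
    (first_return_map a r : R[i]^o).
Proof.
move=> rd; have rd' := ltW rd.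
have : is_solution a r (solution a r).
  by apply: xgetPex; exact: (solution_exists l0 ma al rd').
rewrite /first_return_map; set v := solution a r => -[[L vL] v0 vae].
(* The slope exists separately at almost every point; choosing it pointwise, with an arbitrary value
   0 elsewhere, yields the function that [lip_diff] requires. *)
pose w x := xget (0 : R[i]) [set w : R[i] |
  series (fun i => a i.+1 x * v x ^+ i.+2) @ \oo --> (w : R[i]^o) /\
  has_derivative v x w].
have wE : {ae mu, forall x, x \in `]0, b[ ->
    series (fun i => a i.+1 x * v x ^+ i.+2) @ \oo --> (w x : R[i]^o) /\
    has_derivative v x (w x)}.
  by apply: lebesgue_aeS vae => x vx /vx; exact: xgetPex.
have vw : lip_diff b v w.
  split; last by apply: lebesgue_aeS wE => x vx /vx[].
  exists `|L| => [|x y xb yb]; first exact: normr_ge0.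
  by rewrite (le_trans (vL _ _ xb yb))// ler_wpM2r// ler_norm.
have vs : {ae mu, forall x, x \in `]0, b[ ->
    series (fun i => a i.+1 x * v x ^+ i.+2) @ \oo --> (w x : R[i]^o)}.
  by apply: lebesgue_aeS wE => x vx /vx[].
have vd : forall x, x \in `[0, b] -> normc (v x) <= small_radius l.
  by apply: (small_solution l0 al vw vs); rewrite v0.
apply/cvg_normcP => e e0; near=> N.
have N0 : (0 < N)%N by near: N; exact: nbhs_infty_gt.
(* Truncation at order [N.-1] includes exactly the indices [n < N] of the partial sum. *)
have := transport_solution l0 ma al vw vs N.-1 vd.
rewrite prednK// v0 normc_subC big_ltn// transport_coef0 mul1r expr1.
rewrite (_ : \sum_(1 <= n < N) _ = \sum_(1 <= n < N) return_coef a n * r ^+ n.+1).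
  move=> H; apply: (le_lt_trans H); rewrite mulrAC.
  have -> : 2^-1 ^+ N.-1 = 2 * 2^-1 ^+ N :> R.
    by rewrite -{2}(prednK N0) exprS mulrA mulfV// mul1r.
  by rewrite mulrA; near: N; exact: near_half_lt.
by apply: eq_big_nat => n /andP[n0 _]; rewrite return_coefE.
Unshelve. all: by end_near. Qed.

Lemma cvg_return_series (r : R[i]) : normc r < small_radius l / 2 ->
  cvgn (series (fun n => normc (return_coef a n.+1 * r ^+ n.+2))).
Proof.
move=> rd; have q0 := decay_gt0 R; have d0 := small_radius_gt0 l0.
apply: (@series_le_cvg _ _ (geometric (small_radius l * decay R) (decay R))).
- by move=> n; exact: normc_ge0.
- move=> n; apply: mulr_ge0; last exact: exprn_ge0 (ltW q0).
  by apply: mulr_ge0; exact: ltW.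
- move=> n; rewrite /geometric/= -mulrA -exprS.
  apply: (normc_term_le (ltW d0) (growth_small_radius l0)).
    exact: normc_return_coef_le.
  by have := rd; move: (normc r) => s; lra.
- apply: is_cvg_geometric_series; rewrite gtr0_norm//.
  by have := decay_le R; lra.
Qed.

End return_map.

Theorem theorem2p2 (R : realType) :
  (forall a : nat -> R -> R[i], coefficient_space a ->
     exists2 rho : R, 0 < rho &
       forall r : R[i], normc r < rho ->
         cvgn (series (fun n => normc (return_coef a n.+1 * r ^+ n.+2))) /\
         (fun N => r + \sum_(1 <= n < N) return_coef a n * r ^+ n.+1) @ \oo
           --> (first_return_map a r : R[i]^o)) /\
  @center_set R =
    [set a : nat -> R -> R[i] | coefficient_space a /\
       forall n, (1 <= n)%N -> return_coef a n = 0].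
Proof.
split.
  move=> a /coefficient_space_bound[l [l0 ma al]].
  exists (small_radius l / 2); first by rewrite divr_gt0// small_radius_gt0.
  move=> r rd; split; first exact: (cvg_return_series l0 ma al).
  exact: (first_return_map_series l0 ma al).
apply/seteqP; split=> a /= [aX]; have [l [l0 ma al]] := coefficient_space_bound aX;
  have d0 : 0 < small_radius l / 2 by rewrite divr_gt0// small_radius_gt0.
- move=> [rho rho0 center]; split=> //.
  (* Inside both radii the return map is the sum of the series and also equals [r]. *)
  apply: (power_series_eq_id (growth_gt0 l0)
    (_ : 0 < Num.min rho (small_radius l / 2))).
  + by rewrite lt_min rho0.
  + by move=> n; exact: (normc_return_coef_le l0 ma al).
  + move=> r; rewrite lt_min => /andP[rrho rd].
    by rewrite -{3}(center r rrho); exact: (first_return_map_series l0 ma al rd).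
- move=> a0; split=> //; exists (small_radius l / 2) => // r rd.
  apply: cvg_normc_unique (first_return_map_series l0 ma al rd) _.
  apply/cvg_normcP => e e0; apply: nearW => N.
  rewrite big_nat big1 ?addr0 ?subrr ?normc0// => n /andP[n0 _].
  by rewrite a0// mul0r.
Qed.
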